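(* Let $n\ge1$ and $0<\alpha<2$. For $0<h<1$ let $\mathcal{T}(h)=\sum_{\vec{k}\in\mathbb{Z}^n}h^n\delta_{h\vec{k}}$ and $\mathcal{S}(h)=\sum_{\vec{k}\neq\vec{j}}h^{2n}\frac{1}{|h\vec{k}-h\vec{j}|^{n+\alpha}}\delta_{(h\vec{k},h\vec{j})}$, the sum over $\vec{k},\vec{j}\in\mathbb{Z}^n$. Let $\Phi\in\mathscr{C}_c^\infty(\mathbb{R}^n\times\mathbb{R}^n)$ with $\Phi(x,x)=0$ for all $x$. For each $h$ let $\psi_h:h\mathbb{Z}^n\to\mathbb{R}$ satisfy $\int\varphi\psi_h\,d\mathcal{T}(h)=\iint\varphi(x)\Phi(x,y)\,d\mathcal{S}(h)(x,y)$ for all $\varphi\in\mathscr{C}_c(\mathbb{R}^n)$, and set $\mathcal{Q}(\Phi,h)=\sum_{\vec{k}}\psi_h(h\vec{k})\mathcal{X}_{Q(h\vec{k})}$ with $Q(h\vec{k})=\prod_{m=1}^n[hk_m,h(k_m+1))$. Then for every $\varphi\in\mathscr{C}_c(\mathbb{R}^n)$, $$\lim_{h\to0^+}\int_{\mathbb{R}^n}\mathcal{Q}(\Phi,h)\varphi\,dx=\int_{\mathbb{R}^n}\varphi(x)\,(-\Delta)_y^{\alpha/2}\Phi(x,x)\,dx,$$ that is, $\frac{d\mathcal{S}}{d\mathcal{T}}(\Phi)=(-\Delta)_y^{\alpha/2}\Phi(x,x)$.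
   Context: Here $(-\Delta)_y^{\alpha/2}\Phi(x,x)$ denotes $\lim_{\varepsilon\to0^+}\int_{\{y:|x-y|>\varepsilon\}}\frac{\Phi(x,y)-\Phi(x,x)}{|x-y|^{n+\alpha}}\,dy$ (the paper's convention, without normalizing constant). $\delta_p$ is the unit point mass at $p$. $\frac{d\mathcal{S}}{d\mathcal{T}}(\Phi)$ is the limit as $h\to0^+$, tested against $\varphi\in\mathscr{C}_c(\mathbb{R}^n)$ with Lebesgue measure, of the piecewise-constant quotients $\mathcal{Q}(\Phi,h)$ defined from the Kirchhoff divergence $\psi_h$. *)

(* Defs.v *)
From HB Require Import structures.
From mathcomp Require Import all_boot all_order all_algebra.
From mathcomp Require Import all_classical all_reals all_analysis.
Set Implicit Arguments. Unset Strict Implicit. Unset Printing Implicit Defensive.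
Import Order.TTheory GRing.Theory Num.Theory.
Import numFieldNormedType.Exports.
Local Open Scope classical_set_scope.
Local Open Scope ring_scope.

Section Defs.
Variable R : realType.

Definition enorm n (x : 'rV[R]_n) : R := Num.sqrt (\sum_(i < n) x ord0 i ^+ 2).

(* Lebesgue integral over R^n, as the iterated one-dimensional Lebesgue
   integral over x_1, then x_2, ..., x_n (Fubini). *)
Fixpoint iint (n : nat) : ('rV[R]_n -> R) -> R :=
  match n return ('rV[R]_n -> R) -> R with
  | 0 => fun f => f 0
  | m.+1 => fun f =>
      \int[@lebesgue_measure R]_(t in [set: R])
        iint (fun x : 'rV[R]_m => f (row_mx (\row_(i < 1) t) x))
  end.

Definition dern (V : normedModType R) (vs : seq V) (f : V -> R) : V -> R :=
  foldr (fun v g => fun a => 'D_v g a) f vs.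

Definition smooth (V : normedModType R) (f : V -> R) : Prop :=
  forall vs : seq V,
    continuous (dern vs f) /\ forall (x v : V), derivable (dern vs f) x v.

Definition compact_support (V : normedModType R) (f : V -> R) : Prop :=
  exists M : R, forall p : V, M < `|p| -> f p = 0.

Definition hpt n (h : R) (k : 'rV[int]_n) : 'rV[R]_n :=
  \row_(i < n) (h * (k ord0 i)%:~R).

Definition cube n (h : R) (k : 'rV[int]_n) : set 'rV[R]_n :=
  [set x | forall i : 'I_n,
     h * (k ord0 i)%:~R <= x ord0 i < h * ((k ord0 i)%:~R + 1)].

(* int phi psi_h dT(h) = sum_k h^n phi(hk) psi_h(hk)  (finitely supported);
   psi k stands for psi_h(hk) *)
Definition intTh n (h : R) (phi : 'rV[R]_n -> R) (psi : 'rV[int]_n -> R) : R :=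
  \sum_(k \in [set: 'rV[int]_n]) h ^+ n * (phi (hpt h k) * psi k).

Definition intSh n (alpha h : R) (F : 'rV[R]_n -> 'rV[R]_n -> R) : R :=
  \sum_(p \in [set p : 'rV[int]_n * 'rV[int]_n | p.1 != p.2])
     h ^+ (2 * n) * F (hpt h p.1) (hpt h p.2)
       / (enorm (hpt h p.1 - hpt h p.2)) `^ (n%:R + alpha).

Definition Qfun n (h : R) (psi : 'rV[int]_n -> R) (x : 'rV[R]_n) : R :=
  \sum_(k \in [set: 'rV[int]_n]) psi k * \1_(cube h k) x.

(* (-Delta)_y^{alpha/2} Phi(x,x), principal value, without normalizing constant *)
Definition fraclap n (alpha : R) (Phi : 'rV[R]_n -> 'rV[R]_n -> R) (x : 'rV[R]_n) : R :=
  lim ((fun eps : R =>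
          iint (fun y => \1_([set y | eps < enorm (x - y)]) y *
                  ((Phi x y - Phi x x) / (enorm (x - y)) `^ (n%:R + alpha))))
       @ 0^'+).

End Defs.

Arguments intSh {R n} alpha h F.
Arguments fraclap {R n} alpha Phi x.
Arguments Qfun {R n} h psi x.
Arguments intTh {R n} h phi psi.

(* Main.v *)
(* Since Phi(x,x) = 0, testing the Kirchhoff identity against a bump at hk gives
   psi_h(hk) = h^n sum_{j <> 0} Phi(hk, hk + hj) / |hj|^(n+alpha).  Pairing j with
   -j leaves a second difference of size O(|hj|^2), so the terms with |hj| <= eps
   contribute O(eps^(2-alpha)) uniformly in h and k (dyadic shells).  The terms with
   |hj| > eps form a Riemann sum, with mesh h centred at x, of the truncated integral
   defining the principal value; its only discontinuity is the sphere |y-x| = eps,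
   near which there are O(h^(1/2-n)) cells.  Letting h -> 0 and then eps -> 0, psi_h
   extended constantly on cubes converges uniformly to the fractional Laplacian.
   Iterated integrals are compared with step functions through monotonicity alone,
   so no measurability in several variables is ever needed. *)

Require Import Defs.
From HB Require Import structures.
From mathcomp Require Import all_boot all_order all_algebra.
From mathcomp Require Import all_classical all_reals all_analysis.
From mathcomp Require Import measurable_realfun ring lra zify.
Set Implicit Arguments. Unset Strict Implicit. Unset Printing Implicit Defensive.
Import Order.TTheory GRing.Theory Num.Theory.
Import numFieldNormedType.Exports.
Local Open Scope classical_set_scope.
Local Open Scope ring_scope.

(** * Integrals of bounded functions of one variable *)

(** [fraclap] is a bare limit, so the existence of the principal value has to be established as
    well. The lattice side supplies it: for each cutoff eps and small h, [psi h] is within K eps^(2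
    - alpha) + eta of the cutoff integral, with K independent of eps. Comparing two cutoffs through
    one common [psi h] makes the cutoff integrals Cauchy as eps tends to 0. The cancellation near
    the singularity is therefore exploited only in lattice sums, where reflection is a permutation
    of a finite list. The price is uniformity: no constant may depend on h, on the lattice point or
    on x, and so every bound comes from a global supremum or a global modulus of continuity of a
    continuous compactly supported function. *)

Section Monotone.
Variable R : realType.
Let mu := @lebesgue_measure R.

(* The integral of a nonnegative function is a supremum over the simple
   functions below it, so it is monotone even on nonmeasurable functions. *)
Lemma ge0_le_integral_nonmeas (f g : R -> \bar R) :
  (forall t, 0 <= f t)%E -> (forall t, f t <= g t)%E ->
  (\int[mu]_(t in setT) f t <= \int[mu]_(t in setT) g t)%E.
Proof.
move=> f0 fg; have g0 t : (0 <= g t)%E by exact: le_trans (fg t).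
rewrite !ge0_integralTE//; apply: le_ereal_sup => _ [u /= uf <-].
by exists u => // t; exact: le_trans (fg t).
Qed.

(** A pointwise substitute for integrability: it makes the integrals of the positive and negative
    parts finite without asking for measurability. *)
Definition dominated (C M : R) (f : R -> R) :=
  forall t, `|f t| <= C /\ (M < `|t| -> f t = 0).

Lemma dominated_indic C M f t : dominated C M f ->
  `|f t| <= C * \1_(`[- M, M] : set R) t.
Proof.
move=> /(_ t) [fC fM]; rewrite indicE.
have [tM|tM] := leP `|t| M.
  by rewrite mem_set ?mulr1//= in_itv/= -ler_norml.
by rewrite fM// normr0 mulr_ge0 ?(le_trans _ fC).
Qed.

Lemma integral_indic_itv C M : 0 <= C -> 0 <= M ->
  (\int[mu]_(t in setT) (C * \1_(`[- M, M] : set R) t)%:E = (C * (2 * M))%:E)%E.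
Proof.
move=> C0 M0; under eq_integral do rewrite EFinM.
rewrite ge0_integralZl_EFin//; last first.
  by apply/measurable_EFinP; exact: measurable_indic.
rewrite integral_indic// setIT [X in (_ * X)%E](lebesgue_measure_itv `[- M, M])/= lte_fin.
case: ifPn => [_|]; first by rewrite -EFinD -EFinM; congr EFin; ring.
rewrite -leNgt => MM; have -> : M = 0 by lra.
by rewrite !mulr0 mule0.
Qed.

Lemma dominated_funepos_integral C M f : 0 <= C -> 0 <= M -> dominated C M f ->
  (\int[mu]_(t in setT) ((EFin \o f)^\+ t) <= (C * (2 * M))%:E)%E.
Proof.
move=> C0 M0 df; rewrite -integral_indic_itv//.
apply: ge0_le_integral_nonmeas => t; first by rewrite funepos_ge0.
rewrite funeposE /= -EFin_max lee_fin ge_max.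
rewrite (le_trans (ler_norm _) (dominated_indic t df))/=.
by rewrite (le_trans _ (dominated_indic t df)).
Qed.

Lemma dominatedN C M f : dominated C M f -> dominated C M (fun t => - f t).
Proof.
by move=> df t; have [fC fM] := df t; rewrite normrN; split=> // /fM ->; rewrite oppr0.
Qed.

Lemma dominated_funeneg_integral C M f : 0 <= C -> 0 <= M -> dominated C M f ->
  (\int[mu]_(t in setT) ((EFin \o f)^\- t) <= (C * (2 * M))%:E)%E.
Proof.
move=> C0 M0 /dominatedN /(dominated_funepos_integral C0 M0).
suff -> : ((EFin \o f)^\- = (EFin \o (fun t => (- f t)%R))^\+)%E by [].
by apply/funext => t; rewrite funenegE funeposE /= EFinN.
Qed.

(** The integral is by definition that of the positive part minus that of the negative part, and
    [f <= g] orders both parts. Domination is there for [fine], which sends infinite values to 0 and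
    is monotone only between finite ones. *)
Lemma le_Rintegral_nonmeas C M C' M' f g :
  0 <= C -> 0 <= M -> 0 <= C' -> 0 <= M' ->
  dominated C M f -> dominated C' M' g -> (forall t, f t <= g t) ->
  \int[mu]_(t in setT) f t <= \int[mu]_(t in setT) g t.
Proof.
move=> C0 M0 C0' M0' df dg fg.
have finP (u : \bar R) (D : R) : (0 <= u -> u <= D%:E -> u \is a fin_num)%E.
  by move=> u0 uD; rewrite ge0_fin_numE// (le_lt_trans uD)// ltry.
have pos k : (0 <= \int[mu]_(t in setT) ((EFin \o k)^\+ t))%E.
  by apply: integral_ge0 => t _; exact: funepos_ge0.
have neg k : (0 <= \int[mu]_(t in setT) ((EFin \o k)^\- t))%E.
  by apply: integral_ge0 => t _; exact: funeneg_ge0.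
have fp := finP _ _ (pos f) (dominated_funepos_integral C0 M0 df).
have fn := finP _ _ (neg f) (dominated_funeneg_integral C0 M0 df).
have gp := finP _ _ (pos g) (dominated_funepos_integral C0' M0' dg).
have gn := finP _ _ (neg g) (dominated_funeneg_integral C0' M0' dg).
rewrite /Rintegral; apply: fine_le.
- by rewrite integralE fin_numB fp fn.
- by rewrite integralE fin_numB gp gn.
rewrite integralE [leRHS]integralE; apply: leeB.
- apply: ge0_le_integral_nonmeas => t; first exact: funepos_ge0.
  by rewrite !funeposE /= -!EFin_max lee_fin ge_max !le_max fg lexx orbT.
- apply: ge0_le_integral_nonmeas => t; first exact: funeneg_ge0.
  by rewrite !funenegE /= -!EFin_max lee_fin ge_max !le_max lerN2 fg lexx orbT.
Qed.

Lemma Rintegral_indic_itv C M : 0 <= C -> 0 <= M ->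
  \int[mu]_(t in setT) (C * \1_(`[- M, M] : set R) t) = C * (2 * M).
Proof. by move=> C0 M0; rewrite /Rintegral integral_indic_itv. Qed.

Lemma dominated_Rintegral C M f : 0 <= C -> 0 <= M -> dominated C M f ->
  `|\int[mu]_(t in setT) f t| <= C * (2 * M).
Proof.
move=> C0 M0 df.
have di : dominated C M (fun t => C * \1_(`[- M, M] : set R) t).
  move=> t; rewrite indicE; split.
    by rewrite normrM !ger0_norm// ler_piMr// lern1 leq_b1.
  by move=> tM; rewrite memNset ?mulr0//= in_itv/= -ler_norml leNgt tM.
have dni : dominated C M (fun t => - C * \1_(`[- M, M] : set R) t).
  by move=> t; rewrite mulNr; exact: (dominatedN di).
have bn t : - C * \1_(`[- M, M] : set R) t <= f t <= C * \1_(`[- M, M] : set R) t.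
  by rewrite mulNr -ler_norml; exact: dominated_indic.
rewrite ler_norml -(Rintegral_indic_itv C0 M0); apply/andP; split; last first.
  by apply: (le_Rintegral_nonmeas C0 M0 C0 M0) => // t; have /andP[] := bn t.
rewrite -[leLHS]mulN1r -RintegralZl//; last first.
  apply/integrableP; split.
    by apply/measurable_EFinP; apply: measurable_funM => //; exact: measurable_indic.
  under eq_integral.
    by move=> t _; rewrite /= ger0_norm ?mulr_ge0//; over.
  by rewrite integral_indic_itv// ltry.
apply: (le_Rintegral_nonmeas C0 M0 C0 M0) => //; first last.
  by move=> t; rewrite mulN1r -mulNr; have /andP[] := bn t.
by move=> t; rewrite mulN1r -mulNr.
Qed.

End Monotone.

(** * Step functions of one variable on a grid with arbitrary origin *)

Definition irange (b : nat) : seq int := [seq (i%:Z - b%:Z) | i <- iota 0 (2 * b + 1)].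

Lemma mem_irange b i : (i \in irange b) = (`|i| <= b)%N.
Proof.
apply/mapP/idP => [[j]|ib]; first by rewrite mem_iota; lia.
by exists (absz (i + b%:Z)); [rewrite mem_iota|]; lia.
Qed.

Lemma irange_uniq b : uniq (irange b).
Proof. by rewrite map_inj_uniq ?iota_uniq// => i j; lia. Qed.

Lemma size_irange b : size (irange b) = (2 * b + 1)%N.
Proof. by rewrite size_map size_iota. Qed.

Section Step.
Variable R : realType.
Let mu := @lebesgue_measure R.

Lemma Rintegral_step (a : int -> R) b (x h : R) : 0 < h ->
  (forall i, i \notin irange b -> a i = 0) ->
  \int[mu]_(t in setT) a (Num.floor ((t - x) / h)) = h * \sum_(i <- irange b) a i.
Proof.
move=> h0 a0.
pose I i : set R := `[x + h * i%:~R, x + h * (i%:~R + 1)[%classic.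
have II t i : \1_(I i) t = (Num.floor ((t - x) / h) == i)%:R :> R.
  rewrite indicE; congr (_%:R); congr nat_of_bool; apply/idP/idP.
    rewrite inE /I /= in_itv/= => /andP[t1 t2]; rewrite floor_eq intrD.
    by rewrite ler_pdivlMr// ltr_pdivrMr//; apply/andP; split; lra.
  rewrite floor_eq intrD ler_pdivlMr// ltr_pdivrMr// => /andP[t1 t2].
  by rewrite inE /I /= in_itv/=; apply/andP; split; lra.
have -> : (fun t => a (Num.floor ((t - x) / h))) =
    (fun t => \sum_(i <- irange b) a i * \1_(I i) t).
  apply/funext => t; under eq_bigr do rewrite II.
  have [ib|ib] := boolP (Num.floor ((t - x) / h) \in irange b).
    rewrite (bigD1_seq (Num.floor ((t - x) / h)))//= ?irange_uniq// eqxx mulr1.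
    by rewrite big1 ?addr0// => i /negbTE; rewrite eq_sym => ->; rewrite mulr0.
  rewrite a0// big1_seq// => i /andP[_ ii].
  by case: eqP => [e|]; [rewrite e ii in ib|rewrite mulr0].
have mI i : measurable (I i : set (measurableTypeR R)) by exact: measurable_itv.
have muI i : mu (I i) = h%:E.
  rewrite [LHS]lebesgue_measure_itv/= lte_fin.
  rewrite ifT; last by rewrite ltrD2l ltr_pM2l// ltrDl.
  by rewrite -EFinD; congr EFin; ring.
have inti i : mu.-integrable setT (EFin \o (fun t => \1_(I i) t : R)).
  apply/integrableP; split.
    by apply/measurable_EFinP; apply: measurable_indic; exact: mI.
  under eq_integral.
    by move=> t _; rewrite /= ger0_norm ?ler0n//; over.
  by rewrite integral_indic ?setIT; [rewrite [ltLHS](muI i) ltry|exact: measurableT|exact: mI].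
have intai i : mu.-integrable setT (fun t => (a i * \1_(I i) t)%:E).
  rewrite (_ : (fun _ => _) = (fun t => (a i)%:E * (EFin \o \1_(I i)) t)%E).
    exact: integrableZl.
  by apply/funext => t; rewrite /= EFinM.
rewrite /Rintegral.
have -> : (\int[mu]_(t in setT) (\sum_(i <- irange b) a i * \1_(I i) t)%:E =
    \int[mu]_(t in setT) (\sum_(i <- irange b) (a i * \1_(I i) t)%:E))%E.
  by apply: eq_integral => t _; rewrite sumEFin.
rewrite integral_sum// (eq_bigr (fun i => (a i * h)%:E)).
  by rewrite sumEFin/= -mulr_suml mulrC.
move=> i _; under eq_integral do rewrite EFinM.
rewrite integralZl//; last exact: inti.
rewrite integral_indic; [|exact: measurableT|exact: mI].
by rewrite setIT [X in (_ * X)%E](muI i) EFinM.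
Qed.

End Step.

(** * Riemann sums of iterated integrals *)

(** Has the very shape used in the recursive clause of [iint], so that [iintS] holds by
    computation. *)
Definition cons_row T m (a : T) (k : 'rV[T]_m) : 'rV[T]_m.+1 :=
  row_mx (\row_(_ < 1) a) k.

Definition tail_row T m (k : 'rV[T]_m.+1) : 'rV[T]_m := rsubmx (k : 'rV_(1 + m)).

Section ConsRow.
Variables (T : Type) (m : nat).
Implicit Types (a : T) (k : 'rV[T]_m).

Lemma cons_row0 a k : cons_row a k ord0 ord0 = a.
Proof.
have e : ord0 = lshift m (ord0 : 'I_1) by exact/val_inj.
by rewrite e; apply: etrans (row_mxEl _ k ord0 ord0) _; rewrite mxE.
Qed.

Lemma cons_rowS a k i : cons_row a k ord0 (lift ord0 i) = k ord0 i.
Proof.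
have -> : lift ord0 i = rshift 1 i by apply/val_inj; rewrite /= /bump leq0n.
exact: (row_mxEr (\row_(_ < 1) a) k ord0 i).
Qed.

Lemma tail_rowE (k : 'rV[T]_m.+1) i : tail_row k ord0 i = k ord0 (lift ord0 i).
Proof.
by rewrite mxE; congr (k _ _); apply/val_inj; rewrite /= /bump leq0n.
Qed.

Lemma cons_tail_row (k : 'rV[T]_m.+1) : cons_row (k ord0 ord0) (tail_row k) = k.
Proof.
apply/rowP => i; case: (unliftP ord0 i) => [j|] ->.
  by rewrite cons_rowS tail_rowE.
by rewrite cons_row0.
Qed.

Lemma cons_row_inj a a' k k' : cons_row a k = cons_row a' k' -> a = a' /\ k = k'.
Proof.
move=> e; split; first by rewrite -(cons_row0 a k) e cons_row0.
by apply/rowP => i; rewrite -(cons_rowS a k) e cons_rowS.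
Qed.

End ConsRow.

(** Enumerated by the same recursion as [iint], so that sums over the box and iterated integrals
    unfold together, one coordinate at a time. *)
Fixpoint box (n b : nat) : seq 'rV[int]_n :=
  match n return seq 'rV[int]_n with
  | 0 => [:: 0]
  | m.+1 => [seq cons_row i k | i <- irange b, k <- box m b]
  end.

Lemma box_uniq n b : uniq (box n b).
Proof.
elim: n => //= m IH; apply: allpairs_uniq => //; first exact: irange_uniq.
by move=> [i k] [i' k'] _ _ e; have [/= -> ->] := cons_row_inj e.
Qed.

Lemma mem_box n b (k : 'rV[int]_n) :
  (k \in box n b) = [forall i, `|k ord0 i| <= b]%N.
Proof.
elim: n k => /= [k|m IH k].
  by rewrite thinmx0 inE eqxx; apply/esym/forallP => -[].
apply/allpairsP/forallP => [[[i k'] /= [ii]]|kb].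
  rewrite IH => /forallP kb -> j; case: (unliftP ord0 j) => [l|] ->.
    by rewrite cons_rowS.
  by rewrite cons_row0 -mem_irange.
exists (k ord0 ord0, tail_row k); split; rewrite /= ?cons_tail_row//.
  by rewrite mem_irange.
by rewrite IH; apply/forallP => i; rewrite tail_rowE.
Qed.

Lemma cons_row_in_box m b i (k : 'rV[int]_m) :
  (cons_row i k \in box m.+1 b) = (i \in irange b) && (k \in box m b).
Proof.
apply/allpairsP/andP => [[[i' k'] [/= ii kk e]]|[ii kk]].
  by have [-> ->] := cons_row_inj e.
by exists (i, k).
Qed.

Lemma size_box n b : size (box n b) = ((2 * b + 1) ^ n)%N.
Proof. by elim: n => //= m IH; rewrite size_allpairs IH size_irange expnS. Qed.

Lemma box_opp_perm n b : perm_eq [seq - k | k <- box n b] (box n b).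
Proof.
apply: uniq_perm; [|exact: box_uniq|].
  by rewrite map_inj_uniq ?box_uniq//; exact: oppr_inj.
move=> k; apply/mapP/idP => [[k' + ->]|kb].
  by rewrite !mem_box => /forallP kb; apply/forallP => i; rewrite mxE abszN.
exists (- k); last by rewrite opprK.
by move: kb; rewrite !mem_box => /forallP kb; apply/forallP => i; rewrite mxE abszN.
Qed.

Lemma sum_cons_box (V : nmodType) m b (c : 'rV[int]_m.+1 -> V) :
  \sum_(k <- box m.+1 b) c k =
  \sum_(i <- irange b) \sum_(k <- box m b) c (cons_row i k).
Proof. by rewrite big_allpairs_dep. Qed.

Section IteratedIntegral.
Variable R : realType.

Definition cell n (x : 'rV[R]_n) (h : R) (y : 'rV[R]_n) : 'rV[int]_n :=
  \row_i Num.floor ((y ord0 i - x ord0 i) / h).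

Lemma cell_cons m (x : 'rV[R]_m.+1) h t y :
  cell x h (cons_row t y) =
  cons_row (Num.floor ((t - x ord0 ord0) / h)) (cell (tail_row x) h y).
Proof.
apply/rowP => i; rewrite mxE; case: (unliftP ord0 i) => [j|] ->.
  by rewrite !cons_rowS mxE tail_rowE.
by rewrite !cons_row0.
Qed.

Lemma iintS m (f : 'rV[R]_m.+1 -> R) :
  iint f = \int[@lebesgue_measure R]_(t in setT) iint (fun y => f (cons_row t y)).
Proof. by []. Qed.

Lemma iint_step n (x : 'rV[R]_n) h b (c : 'rV[int]_n -> R) : 0 < h ->
  (forall k, k \notin box n b -> c k = 0) ->
  iint (fun y => c (cell x h y)) = h ^+ n * \sum_(k <- box n b) c k.
Proof.
move=> h0; elim: n x c => [x c _|m IH x c c0].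
  by rewrite /= big_seq1 expr0 mul1r; congr c; rewrite thinmx0.
rewrite iintS; pose a i := h ^+ m * \sum_(k <- box m b) c (cons_row i k).
under eq_fun do under eq_fun do rewrite cell_cons.
have -> : (fun t => iint (fun y => c (cons_row (Num.floor ((t - x ord0 ord0) / h))
    (cell (tail_row x) h y)))) = fun t => a (Num.floor ((t - x ord0 ord0) / h)).
  apply/funext => t; rewrite (IH _ (fun k => c (cons_row _ k)))// => k kb.
  by rewrite c0// cons_row_in_box (negbTE kb) andbF.
rewrite (Rintegral_step _ (b := b) h0) => [|i ib].
  by rewrite sum_cons_box /a -mulr_sumr mulrA exprS.
by rewrite /a big1 ?mulr0// => k _; rewrite c0// cons_row_in_box (negbTE ib).
Qed.

(** The support condition is put on single coordinates so that it passes to slices with the same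
    [M]. *)
Definition bounded_supported n (C M : R) (f : 'rV[R]_n -> R) :=
  forall y, `|f y| <= C /\ forall i, M < `|y ord0 i| -> f y = 0.

Lemma bounded_supported_cons m C M (f : 'rV[R]_m.+1 -> R) t :
  bounded_supported C M f -> bounded_supported C M (fun y => f (cons_row t y)).
Proof.
move=> df y; have [fC fM] := df (cons_row t y); split=> // i iM.
by apply: (fM (lift ord0 i)); rewrite cons_rowS.
Qed.

Lemma bounded_supported_cons_out m C M (f : 'rV[R]_m.+1 -> R) t : M < `|t| ->
  bounded_supported C M f -> bounded_supported 0 M (fun y => f (cons_row t y)).
Proof.
move=> tM df y; have [fC fM] := df (cons_row t y).
by rewrite (fM ord0) ?cons_row0// normr0.
Qed.

(** The bound in dimension [m] is a premise because this lemma is used inside the induction that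
    proves that bound, and again once it is available. *)
Lemma iint_dominated m C M (f : 'rV[R]_m.+1 -> R) :
  (forall C (f : 'rV[R]_m -> R), 0 <= C -> bounded_supported C M f ->
    `|iint f| <= C * (2 * M) ^+ m) ->
  0 <= C -> bounded_supported C M f ->
  dominated (C * (2 * M) ^+ m) M (fun t => iint (fun y => f (cons_row t y))).
Proof.
move=> IH C0 df t; split; first exact/IH/bounded_supported_cons.
(* A slice outside the support is bounded by 0, so the bound alone forces its integral to vanish. *)
move=> tM; apply/eqP; rewrite -normr_le0 -(mul0r ((2 * M) ^+ m)).
exact/IH/(bounded_supported_cons_out tM df).
Qed.

Lemma iint_bound n C M (f : 'rV[R]_n -> R) : 0 <= C -> 0 <= M ->
  bounded_supported C M f -> `|iint f| <= C * (2 * M) ^+ n.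
Proof.
move=> + M0; elim: n C f => [C f _ df|m IH C f C0 df].
  by rewrite /= expr0 mulr1; have [] := df 0.
rewrite iintS exprSr mulrA; apply: dominated_Rintegral => //.
  by rewrite mulr_ge0// exprn_ge0// mulr_ge0.
exact: iint_dominated.
Qed.

Lemma le_iint n C M C' M' (f g : 'rV[R]_n -> R) :
  0 <= C -> 0 <= M -> 0 <= C' -> 0 <= M' ->
  bounded_supported C M f -> bounded_supported C' M' g ->
  (forall y, f y <= g y) -> iint f <= iint g.
Proof.
move=> C0 M0 C0' M0'; elim: n f g => [f g _ _ fg|m IH f g df dg fg]; first exact: fg.
rewrite !iintS.
apply: (@le_Rintegral_nonmeas _ (C * (2 * M) ^+ m) M (C' * (2 * M') ^+ m) M') => //.
- by rewrite mulr_ge0// exprn_ge0// mulr_ge0.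
- by rewrite mulr_ge0// exprn_ge0// mulr_ge0.
- by apply: iint_dominated => // *; exact: iint_bound.
- by apply: iint_dominated => // *; exact: iint_bound.
by move=> t; apply: IH => //; exact: bounded_supported_cons.
Qed.

Lemma coord_le_norm n (x : 'rV[R]_n) i : `|x ord0 i| <= `|x|.
Proof.
rewrite [leRHS]/Num.norm /= mx_normrE; apply/bigmax_geP; right => /=.
by exists (ord0, i).
Qed.

(** Cells with indices from -b to b reach from -h b to h (b + 1) around [x]; the extra unit is the
    length of the last cell. *)
Lemma cell_box_bounded_supported n (x : 'rV[R]_n) h b (f : 'rV[R]_n -> R) C : 0 < h ->
  (forall y, `|f y| <= C) -> (forall y, cell x h y \notin box n b -> f y = 0) ->
  bounded_supported C (`|x| + h * b.+1%:R) f.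
Proof.
move=> h0 fC f0 y; split=> // i yi; apply: f0; rewrite mem_box negb_forall.
apply/existsP; exists i; rewrite -ltnNge mxE; apply: contraTT yi => ib.
have {}ib : `|Num.floor ((y ord0 i - x ord0 i) / h)| <= b%:Z.
  by rewrite -abszE lez_nat leqNgt.
move: ib; rewrite ler_norml floor_ge_int => /andP[].
rewrite ler_pdivlMr// => i1.
rewrite -ltzD1 floor_lt_int ltr_pdivrMr// => i2.
have xi := coord_le_norm x i.
rewrite -leNgt; move: xi; rewrite !ler_norml => /andP[x1 x2].
move: i1 i2; rewrite -natr1 rmorphN /= intrD /= => i1 i2.
by apply/andP; split; lra.
Qed.

(* Monotonicity sandwiches [f] between two step functions, hence no
   measurability of [f] is required. *)
Lemma iint_riemann n (x : 'rV[R]_n) h b (f : 'rV[R]_n -> R) (c e : 'rV[int]_n -> R) :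
  0 < h ->
  (forall y, cell x h y \in box n b -> `|f y - c (cell x h y)| <= e (cell x h y)) ->
  (forall y, cell x h y \notin box n b -> f y = 0) ->
  `|iint f - h ^+ n * \sum_(k <- box n b) c k| <= h ^+ n * \sum_(k <- box n b) e k.
Proof.
move=> h0 fce f0.
pose lo k := if k \in box n b then c k - e k else 0.
pose up k := if k \in box n b then c k + e k else 0.
(* A crude bound: its value never enters the estimate, it only makes [le_iint] applicable. *)
pose C := \sum_(k <- box n b) (`|c k| + `|e k|).
have C0 : 0 <= C by apply: sumr_ge0 => k _; rewrite addr_ge0.
have ceC k : k \in box n b -> `|c k| + `|e k| <= C.
  move=> kb; rewrite /C (bigD1_seq k) ?box_uniq//= lerDl.
  by apply: sumr_ge0 => i _; rewrite addr_ge0.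
pose M := `|x| + h * b.+1%:R.
have M0 : 0 <= M by rewrite addr_ge0// mulr_ge0// ltW.
have blo : bounded_supported C M (fun y => lo (cell x h y)).
  apply: (@cell_box_bounded_supported _ _ _ b) => // y; rewrite /lo.
    by case: ifP => [kb|_]; rewrite ?normr0// (le_trans (ler_normB _ _))// ceC.
  by move/negbTE ->.
have bup : bounded_supported C M (fun y => up (cell x h y)).
  apply: (@cell_box_bounded_supported _ _ _ b) => // y; rewrite /up.
    by case: ifP => [kb|_]; rewrite ?normr0// (le_trans (ler_normD _ _))// ceC.
  by move/negbTE ->.
have bf : bounded_supported C M f.
  apply: (@cell_box_bounded_supported _ _ _ b) => // y.
  have [kb|kb] := boolP (cell x h y \in box n b); last by rewrite f0// normr0.
  apply: le_trans (ceC _ kb); rewrite -(subrK (c (cell x h y)) (f y)) addrC.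
  rewrite (le_trans (ler_normD _ _))// lerD2l (le_trans (fce _ kb))//.
  exact: ler_norm.
have lof y : lo (cell x h y) <= f y <= up (cell x h y).
  rewrite /lo /up; case: ifPn => kb; last by rewrite f0// lexx.
  by have := fce _ kb; rewrite ler_norml => /andP[? ?]; apply/andP; split; lra.
have lo0 k : k \notin box n b -> lo k = 0 by rewrite /lo => /negbTE ->.
have up0 k : k \notin box n b -> up k = 0 by rewrite /up => /negbTE ->.
have Elo : \sum_(k <- box n b) lo k = \sum_(k <- box n b) c k - \sum_(k <- box n b) e k.
  rewrite -sumrB big_seq_cond [RHS]big_seq_cond; apply: eq_bigr => k /andP[kb _].
  by rewrite /lo kb.
have Eup : \sum_(k <- box n b) up k = \sum_(k <- box n b) c k + \sum_(k <- box n b) e k.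
  rewrite -big_split big_seq_cond [RHS]big_seq_cond; apply: eq_bigr => k /andP[kb _].
  by rewrite /up kb.
rewrite ler_distl -mulrBr -mulrDr -Elo -Eup.
rewrite -(iint_step x h0 lo0) -(iint_step x h0 up0); apply/andP; split.
  by apply: (le_iint C0 M0 C0 M0) => // y; have /andP[] := lof y.
by apply: (le_iint C0 M0 C0 M0) => // y; have /andP[] := lof y.
Qed.

End IteratedIntegral.

(** * Lattice point counting *)

Section LatticeSums.
Variable R : realType.

Definition sqnorm n (k : 'rV[int]_n) : R := \sum_(i < n) (k ord0 i)%:~R ^+ 2.

Lemma sqnorm_cons m i (k : 'rV[int]_m) :
  sqnorm (cons_row i k) = i%:~R ^+ 2 + sqnorm k.
Proof.
rewrite /sqnorm big_ord_recl cons_row0; congr (_ + _).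
by apply: eq_bigr => j _; rewrite cons_rowS.
Qed.

(* If [m] is the least [|i|] occurring, then [(|i| - m)^2 <= i^2 - m^2 <= l]. *)
Lemma count_sqr_itv b (A l : R) : 0 <= l ->
  \sum_(i <- irange b) (A <= i%:~R ^+ 2 <= A + l)%R%:R <= 2 * (Num.sqrt l + 1) :> R.
Proof.
move=> l0; pose P (i : int) := A <= i%:~R ^+ 2 <= A + l.
have -> : \sum_(i <- irange b) (P i)%:R = (size ([seq i <- irange b | P i]))%:R :> R.
  by rewrite -natr_sum; congr _%:R; rewrite size_filter -sum1_count [RHS]big_mkcond.
set s := [seq i <- irange b | P i].
have sl0 : 0 <= Num.sqrt l by exact: sqrtr_ge0.
have [/size0nil s0|snil] := eqVneq (size s) 0%N.
  by rewrite s0/=; lra.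
have exm : exists m, has (fun i => `|i|%N == m) s.
  case: s snil => // i s' _; exists `|i|%N; by rewrite /= eqxx.
case: (ex_minnP exm) => m /hasP[j js /eqP jm] mmin.
pose T := Num.truncn (Num.sqrt l).
(* Each absolute value lies between m and m + T, and the two signs double the count. *)
pose u := [seq (m + t)%:Z | t <- iota 0 T.+1] ++ [seq - (m + t)%:Z | t <- iota 0 T.+1].
have : (size s <= size u)%N.
  apply: uniq_leq_size => [|i is_]; first by rewrite filter_uniq// irange_uniq.
  have mi : (m <= `|i|)%N by apply: mmin; apply/hasP; exists i.
  have iT : (`|i| - m <= T)%N.
    rewrite /T truncn_ge_nat// -(@ler_pXn2r _ 2)// ?nnegrE//.
    rewrite sqr_sqrtr// natrB//.
    move: is_ js; rewrite !mem_filter /P => /andP[/andP[_ i2] _] /andP[/andP[j1 _] _].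
    have ei : (`|i|%N)%:R ^+ 2 = i%:~R ^+ 2 :> R.
      by rewrite natr_absz intr_norm real_normK// num_real.
    have ej : m%:R ^+ 2 = j%:~R ^+ 2 :> R.
      by rewrite -jm natr_absz intr_norm real_normK// num_real.
    have m0 : 0 <= m%:R :> R by rewrite ler0n.
    have im : m%:R <= (`|i|%N)%:R :> R by rewrite ler_nat.
    nra.
  rewrite mem_cat; case: (lerP 0 i) => i0; apply/orP; [left|right].
    by apply/mapP; exists (`|i| - m)%N; rewrite ?mem_iota; lia.
  by apply/mapP; exists (`|i| - m)%N; rewrite ?mem_iota; lia.
rewrite size_cat !size_map size_iota -(ler_nat R) => /le_trans; apply.
have : T%:R <= Num.sqrt l by rewrite truncn_le.
by rewrite natrD -natr1; lra.
Qed.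

(** Fixing all coordinates but the last only shifts [A], so each of the (2b + 1)^n lines parallel to
    the last axis meets the annulus in a one-dimensional window of the same length [l]. Cruder than
    the area of a sphere, but the resulting error still vanishes with h. *)
Lemma count_annulus n b (A l : R) : 0 <= l ->
  \sum_(k <- box n.+1 b) (A <= sqnorm k <= A + l)%R%:R <=
  (2 * b + 1)%:R ^+ n * (2 * (Num.sqrt l + 1)) :> R.
Proof.
move=> l0; elim: n A => [A|n IH A]; rewrite sum_cons_box.
  rewrite expr0 mul1r; apply: le_trans (count_sqr_itv b A l0).
  apply: ler_sum => i _.
  by rewrite /= big_seq1 sqnorm_cons /sqnorm big_ord0 addr0.
apply: (le_trans (y := \sum_(i <- irange b) ((2 * b + 1)%:R ^+ n * (2 * (Num.sqrt l + 1))))).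
  apply: ler_sum => i _; apply: le_trans (IH (A - i%:~R ^+ 2)).
  apply: ler_sum => k _; rewrite sqnorm_cons ler_nat.
  by apply/eq_leq; congr nat_of_bool; apply/idP/idP => /andP[? ?]; apply/andP; split; lra.
by rewrite big_const_seq count_predT size_irange iter_addr_0 -[leLHS]mulr_natl exprS mulrA lexx.
Qed.

Lemma hptN n (h : R) (k : 'rV[int]_n) : hpt h (- k) = - hpt h k.
Proof. by apply/rowP => i; rewrite !mxE rmorphN mulrN. Qed.

Lemma hptD n (h : R) (k l : 'rV[int]_n) : hpt h (k + l) = hpt h k + hpt h l.
Proof. by apply/rowP => i; rewrite !mxE rmorphD mulrDr. Qed.

Lemma hpt0 n (h : R) : hpt h (0 : 'rV[int]_n) = 0.
Proof. by apply/rowP => i; rewrite !mxE mulr0. Qed.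

Lemma norm_row_le n (x : 'rV[R]_n) M : 0 <= M ->
  (`|x| <= M) = [forall i, `|x ord0 i| <= M].
Proof.
move=> M0; apply/idP/forallP => [xM i|xM].
  exact: le_trans (coord_le_norm x i) xM.
rewrite /Num.norm/= mx_normrE; apply/bigmax_leP; split=> // -[i j] _ /=.
by rewrite (ord1 i).
Qed.

Lemma hpt_norm_ge n (h : R) (k : 'rV[int]_n) : 0 < h -> k != 0 -> h <= `|hpt h k|.
Proof.
move=> h0 k0; have [i ki] : exists i, k ord0 i != 0.
  apply/existsP; apply: contraNT k0; rewrite negb_exists => /forallP k0.
  by apply/eqP/rowP => i; rewrite mxE; apply/eqP; rewrite -[_ == _]negbK.
apply: le_trans (coord_le_norm _ i); rewrite mxE normrM (gtr0_norm h0).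
by rewrite ler_pMr// -intr_norm (ler_int R 1); lia.
Qed.

(** Indices are at most T in absolute value with T h <= r, and h (2 T + 1) <= 2 r + h <= 3 r. *)
Lemma count_hpt_ball n b (h r : R) : 0 < h -> h <= r ->
  h ^+ n * \sum_(k <- box n b | `|hpt h k| <= r) 1 <= (3 * r) ^+ n.
Proof.
move=> h0 hr; have r0 : 0 < r by exact: lt_le_trans hr.
have -> : \sum_(k <- box n b | `|hpt h k| <= r) 1 =
    (size [seq k <- box n b | (`|hpt h k| <= r)%R])%:R :> R.
  by rewrite size_filter -sum1_count natr_sum.
set T := Num.truncn (r / h).
have sT : (size [seq k <- box n b | (`|hpt h k| <= r)%R] <= size (box n T))%N.
  apply: uniq_leq_size => [|k]; first by rewrite filter_uniq// box_uniq.
  rewrite mem_filter norm_row_le ?(ltW r0)// => /andP[/forallP kr _].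
  rewrite mem_box; apply/forallP => i; have := kr i.
  rewrite mxE normrM (gtr0_norm h0) mulrC -ler_pdivlMr// => kr'.
  by rewrite /T truncn_ge_nat ?divr_ge0 ?(ltW r0) ?(ltW h0)// natr_absz intr_norm.
have Th : T%:R * h <= r.
  by rewrite -ler_pdivlMr// truncn_le divr_ge0// ltW.
apply: (@le_trans _ _ (h ^+ n * (size (box n T))%:R)).
  by rewrite ler_wpM2l ?exprn_ge0 ?ler_nat// ltW.
rewrite size_box natrX -exprMn; apply: lerXn2r; rewrite ?nnegrE ?mulr_ge0 ?(ltW h0) ?(ltW r0)//.
rewrite natrD natrM; lra.
Qed.

End LatticeSums.

(** * Small-scale lattice sums *)

Section Enorm.
Variable R : realType.

Lemma enorm_ge0 n (z : 'rV[R]_n) : 0 <= enorm z.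
Proof. exact: sqrtr_ge0. Qed.

Lemma enorm_sqr n (z : 'rV[R]_n) : enorm z ^+ 2 = \sum_(i < n) z ord0 i ^+ 2.
Proof. by rewrite sqr_sqrtr// sumr_ge0// => i _; rewrite sqr_ge0. Qed.

Lemma norm_le_enorm n (z : 'rV[R]_n) : `|z| <= enorm z.
Proof.
rewrite norm_row_le ?enorm_ge0//; apply/forallP => i.
rewrite -(@ler_pXn2r _ 2)// ?nnegrE ?enorm_ge0// enorm_sqr real_normK ?num_real//.
by rewrite (bigD1 i)//= lerDl sumr_ge0// => j _; rewrite sqr_ge0.
Qed.

Lemma enormN n (z : 'rV[R]_n) : enorm (- z) = enorm z.
Proof.
by congr Num.sqrt; apply: eq_bigr => i _; rewrite mxE sqrrN.
Qed.

Lemma enorm_hpt_sqr n (h : R) (k : 'rV[int]_n) :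
  enorm (hpt h k) ^+ 2 = h ^+ 2 * sqnorm R k.
Proof.
by rewrite enorm_sqr /sqnorm mulr_sumr; apply: eq_bigr => i _; rewrite mxE exprMn.
Qed.

End Enorm.

Lemma powR_half (R : realType) (x q : R) : 0 <= x -> (x / 2) `^ q = x `^ q / 2 `^ q.
Proof.
by move=> x0; rewrite powRM// -[2^-1](@powR_inv1 R 2)// -powRrM mulN1r powRN.
Qed.

Section Tail.
Variables (R : realType) (n : nat) (alpha : R).
Hypothesis alpha02 : 0 < alpha < 2.
Let p : R := n%:R + alpha.

(** The geometric series of the shell bounds: 3^n 2^(n + alpha) is the constant of one dyadic shell
    in [shell_power], and halving the radius multiplies the bound by 2^(-(2 - alpha)), which is
    below 1 since alpha < 2. *)
Definition tail_const : R := 3 ^+ n * 2 `^ (n%:R + alpha) / (1 - 2 `^ (- (2 - alpha))).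

Lemma exponent_gt0 : 0 < p.
Proof. by case/andP: alpha02 => a0 _; rewrite ltr_wpDl. Qed.

(** The left side is the normalised number of lattice points in a shell times a bound for each
    summand, with the numerator taken at the outer radius and the denominator at the inner one. *)
Lemma shell_power (rho : R) : 0 < rho ->
  (3 * rho) ^+ n * (rho ^+ 2 / (rho / 2) `^ p) =
  3 ^+ n * 2 `^ p * rho `^ (2 - alpha).
Proof.
move=> r0; rewrite powR_half ?(ltW r0)//.
have -> : rho `^ (2 - alpha) = rho ^+ n * rho ^+ 2 / rho `^ p.
  rewrite -exprD -powR_mulrn ?(ltW r0)// -powRB ?(gt_eqF r0) ?implybT// natrD /p.
  by congr (_ `^ _); ring.
have p1 : rho `^ p != 0 by rewrite gt_eqF ?powR_gt0.
have p2 : (2 : R) `^ p != 0 by rewrite gt_eqF ?powR_gt0.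
by rewrite exprMn; field; rewrite p1 p2.
Qed.

Lemma shell_sum b (h rho : R) : 0 < h -> h <= rho ->
  h ^+ n * \sum_(k <- box n b | rho / 2 < `|hpt h k| <= rho)
    (`|hpt h k| ^+ 2 / `|hpt h k| `^ p) <=
  3 ^+ n * 2 `^ p * rho `^ (2 - alpha).
Proof.
move=> h0 hr; have r0 : 0 < rho by exact: lt_le_trans hr.
rewrite -shell_power//; set c := _ / _ `^ p.
have c0 : 0 <= c by rewrite divr_ge0 ?powR_ge0 ?exprn_ge0// ltW.
apply: (@le_trans _ _ (h ^+ n * (c * \sum_(k <- box n b | `|hpt h k| <= rho) 1))).
  rewrite ler_wpM2l ?exprn_ge0 ?(ltW h0)// mulr_sumr.
  rewrite big_mkcond [leRHS]big_mkcond; apply: ler_sum => k _.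
  case: ifP => [/andP[k1 k2]|_]; last by case: ifP => _; rewrite ?mulr1.
  rewrite k2 mulr1 /c; apply: ler_pM => //.
  - by rewrite lerXn2r ?nnegrE// ltW.
  rewrite lef_pV2 ?posrE ?powR_gt0//.
  - apply: ge0_ler_powR; rewrite ?nnegrE ?(ltW exponent_gt0)//.
      by rewrite divr_ge0// ltW.
    exact: ltW.
  - by apply: le_lt_trans k1; rewrite divr_ge0// ltW.
  - by rewrite divr_gt0.
rewrite mulrCA mulrC; apply: ler_wpM2r => //; exact: count_hpt_ball.
Qed.

Lemma two_pow_lt1 : 0 < 1 - 2 `^ (- (2 - alpha)) :> R.
Proof.
case/andP: alpha02 => a0 a2.
rewrite subr_gt0 powRN invf_lt1 ?powR_gt0//.
rewrite -[ltLHS](powRr0 2) lt_neqAle ler_powR ?ler1n ?subr_ge0 ?(ltW a2)// andbT.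
by rewrite powRr0 eq_sym powR_eq1; apply/negP => /or3P[]; lra.
Qed.

Lemma tail_const_gt0 : 0 < tail_const.
Proof. by rewrite divr_gt0 ?two_pow_lt1// mulr_gt0 ?exprn_gt0 ?powR_gt0. Qed.

(** Induction on the number of halvings that bring [r] below [h], where no nonzero lattice point is
    left. No infinite series is summed, because [tail_const] solves the recursion c r^s = c (r/2)^s
    + (bound of one shell) with s = 2 - alpha. *)
Lemma tail_sum b (h r : R) : 0 < h -> 0 < r ->
  h ^+ n * \sum_(k <- box n b | (k != 0) && (`|hpt h k| <= r))
    (`|hpt h k| ^+ 2 / `|hpt h k| `^ p) <= tail_const * r `^ (2 - alpha).
Proof.
move=> h0 r0.
have rhs0 s : 0 <= tail_const * s `^ (2 - alpha).
  by rewrite mulr_ge0 ?powR_ge0// ltW ?tail_const_gt0.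
have small s : s < h -> h ^+ n * \sum_(k <- box n b | (k != 0) && (`|hpt h k| <= s))
    (`|hpt h k| ^+ 2 / `|hpt h k| `^ p) <= tail_const * s `^ (2 - alpha).
  move=> sh; rewrite big1 ?mulr0// => k /andP[k0 ks].
  by have := hpt_norm_ge h0 k0; rewrite leNgt (le_lt_trans ks sh).
have [K rK] : exists K, r < 2 ^+ K * h.
  exists (Num.truncn (r / h)).+1; rewrite -ltr_pdivrMr//.
  apply: lt_le_trans (truncnS_gt _) _.
  by rewrite -natrX ler_nat ltnW// ltn_expl.
elim: K r r0 rK => [|K IH] r r0 rK.
  by apply: small; rewrite -[h]mul1r -(expr0 2).
have [rh|hr] := ltP r h; first exact: small.
rewrite (bigID (fun k => `|hpt h k| <= r / 2))/= mulrDr.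
have -> : tail_const * r `^ (2 - alpha) =
    tail_const * (r / 2) `^ (2 - alpha) + 3 ^+ n * 2 `^ p * r `^ (2 - alpha).
  rewrite powR_half ?(ltW r0)// -(powRN 2) /tail_const -/p.
  by field; rewrite gt_eqF// two_pow_lt1.
apply: lerD.
  have r20 : 0 < r / 2 by rewrite divr_gt0.
  have r2K : r / 2 < 2 ^+ K * h by rewrite ltr_pdivrMr// mulrAC -exprSr.
  apply: le_trans (IH (r / 2) r20 r2K).
  rewrite ler_wpM2l ?exprn_ge0 ?(ltW h0)//.
  rewrite big_mkcond [leRHS]big_mkcond; apply: ler_sum => k _.
  case: ifP => [/andP[/andP[-> _] ->]|_]; first by rewrite lexx.
  by case: ifP => // _; rewrite divr_ge0 ?powR_ge0 ?exprn_ge0.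
apply: le_trans (shell_sum b h0 hr).
rewrite ler_wpM2l ?exprn_ge0 ?(ltW h0)//.
rewrite big_mkcond [leRHS]big_mkcond; apply: ler_sum => k _.
case: ifP => [/andP[/andP[_ ->]]|_]; first by rewrite -ltNge => ->.
by case: ifP => // _; rewrite divr_ge0 ?powR_ge0 ?exprn_ge0.
Qed.

(** The sup norm is at most the Euclidean one, so passing to it enlarges the range of summation and
    shrinks the denominators; the sup-norm shells therefore bound the Euclidean sum. *)
Lemma symmetric_tail b (h eps D : R) (F : 'rV[R]_n -> R) : 0 < h -> 0 < eps ->
  0 <= D -> (forall z, `|F z + F (- z)| <= D * `|z| ^+ 2) ->
  `|h ^+ n * \sum_(k <- box n b | (k != 0) && (enorm (hpt h k) <= eps))
     (F (hpt h k) / enorm (hpt h k) `^ p)| <= D * tail_const * eps `^ (2 - alpha).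
Proof.
move=> h0 e0 D0 FD; set S := \sum_(k <- _ | _) _.
have SN : S = \sum_(k <- box n b | (k != 0) && (enorm (hpt h k) <= eps))
     (F (- hpt h k) / enorm (hpt h k) `^ p).
  rewrite /S -(perm_big _ (box_opp_perm n b)) big_map.
  by apply: eq_big => k; rewrite ?oppr_eq0 ?hptN ?enormN// => _; rewrite hptN enormN.
have S2 : `|S + S| <= D * \sum_(k <- box n b | (k != 0) && (`|hpt h k| <= eps))
    (`|hpt h k| ^+ 2 / `|hpt h k| `^ p).
  rewrite {2}SN -big_split/= (le_trans (ler_norm_sum _ _ _))// mulr_sumr.
  rewrite big_mkcond [leRHS]big_mkcond; apply: ler_sum => k _.
  case: ifP => [/andP[k0 ke]|_]; last first.
    by case: ifP => // _; rewrite mulr_ge0// divr_ge0 ?powR_ge0 ?exprn_ge0.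
  rewrite k0 (le_trans (norm_le_enorm _) ke)/= -mulrDl normrM mulrA.
  have hk0 : 0 < `|hpt h k| by apply: lt_le_trans (hpt_norm_ge h0 k0).
  apply: ler_pM => //; rewrite ger0_norm ?invr_ge0 ?powR_ge0//.
  rewrite lef_pV2 ?posrE ?powR_gt0//.
    by apply: ge0_ler_powR; rewrite ?nnegrE ?enorm_ge0 ?(ltW exponent_gt0)// norm_le_enorm.
  exact: lt_le_trans (norm_le_enorm _).
have SS : `|S| <= `|S + S| by rewrite -mulr2n normrMn mulr2n lerDl.
rewrite normrM ger0_norm ?exprn_ge0 ?(ltW h0)// -mulrA.
apply: le_trans (ler_wpM2l D0 (tail_sum b h0 e0)).
by rewrite mulrCA ler_wpM2l ?exprn_ge0 ?(ltW h0)// (le_trans SS).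
Qed.

End Tail.

(** * Compact support and second differences *)

Section CompactSupport.
Variables (R : realType) (V : normedModType R).
(** Kept abstract because the two lemmas below serve both for row vectors and for pairs of them. *)
Hypothesis ball_compact : forall M, compact [set p : V | `|p| <= M].

Lemma compact_support_bounded (f : V -> R) : continuous f -> compact_support f ->
  exists2 C, 0 <= C & forall p, `|f p| <= C.
Proof.
move=> cf [M fM].
have /compact_bounded[N [_ NK]] : compact (f @` [set p : V | `|p| <= M]).
  by apply: continuous_compact => //; exact: continuous_subspaceT.
exists (`|N| + 1) => [|p]; first by rewrite addr_ge0.
have [pM|pM] := leP `|p| M; last by rewrite fM// normr0 addr_ge0.
apply: NK; last by exists p.
by rewrite (le_lt_trans (ler_norm _))// ltrDl.
Qed.

Lemma compact_support_unif_continuous (f : V -> R) : continuous f -> compact_support f ->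
  forall e, 0 < e -> exists2 d, 0 < d & forall p q, `|p - q| <= d -> `|f p - f q| <= e.
Proof.
move=> cf [M fM] e e0.
pose P (d : R) p := forall q, `|p - q| <= d -> `|f p - f q| <= e.
have /compact_near_coveringP cK := ball_compact (M := M).
have [d d0 Pd] : exists2 d, 0 < d & [set p : V | `|p| <= M] `<=` P d.
  have : \forall d \near (0 : R)^'+, [set p : V | `|p| <= M] `<=` P d.
    apply: cK => p _; have /cvgrPdist_lt/(_ (e / 2)) := cf p.
    rewrite divr_gt0// => /(_ isT)/nbhs_ballP[r /= r0 fr].
    exists (ball p (r / 2), [set d | 0 < d < r / 2]); first split => /=.
    - by apply: nbhsx_ballx; rewrite divr_gt0.
    - near=> d; apply/andP; split; near: d; first exact: nbhs_right_gt.
      by apply: nbhs_right_lt; rewrite divr_gt0.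
    move=> [p' d] [/= + /andP[d0 dr]] q p'q; rewrite -ball_normE /= => pp'.
    have f1 : `|f p - f p'| < e / 2.
      by apply: fr; rewrite -ball_normE /= (lt_trans pp')// ltr_pdivrMr// mulr2n mulrDr mulr1 ltrDl.
    have f2 : `|f p - f q| < e / 2.
      apply: fr; rewrite -ball_normE /= -(subrK p' p) -addrA (le_lt_trans (ler_normD _ _))//.
      by rewrite [r]splitr ltr_leD// (le_trans p'q)// ltW.
    rewrite -(subrK (f p) (f p')) -addrA (le_trans (ler_normD _ _))//.
    by rewrite [e]splitr lerD// ltW// distrC.
  move=> H; have [d [/= d0 dP]] : exists d, 0 < d /\ [set p : V | `|p| <= M] `<=` P d.
    near (0 : R)^'+ => d; exists d; split; near: d => //; exact: nbhs_right_gt.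
  by exists d.
exists d => // p q pq.
have [pM|pM] := leP `|p| M; first exact: Pd.
have [qM|qM] := leP `|q| M; first by rewrite distrC; apply: Pd => //; rewrite distrC.
by rewrite !fM// subrr normr0 ltW.
Unshelve. all: by end_near. Qed.

End CompactSupport.

Lemma row_ball_compact (R : realType) n (M : R) : compact [set p : 'rV[R]_n | `|p| <= M].
Proof.
apply: bounded_closed_compact.
  by exists M; split; [exact: num_real|move=> N MN p /= pM; rewrite (le_trans pM)// ltW].
rewrite (_ : [set p | _] = Num.norm @^-1` [set x | x <= M])//.
by apply: closed_comp; [move=> p _; exact: norm_continuous|exact: closed_le].
Qed.

Lemma row_pair_ball_compact (R : realType) n m (M : R) :
  compact [set p : 'rV[R]_n * 'rV[R]_m | `|p| <= M].
Proof.
rewrite (_ : mkset _ = [set p : 'rV[R]_n | `|p| <= M] `*` [set p : 'rV[R]_m | `|p| <= M]).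
  by apply: compact_setX; exact: row_ball_compact.
by apply/seteqP; split=> -[p q] /=; rewrite prod_normE /= ge_max => /andP.
Qed.

Section Derivatives.
Variable R : realType.

Lemma mvt_abs (g dg : R -> R) t : (forall s : R, is_derive s 1 g (dg s)) ->
  exists2 c, `|c| <= `|t| & g t - g 0 = dg c * t.
Proof.
move=> gd.
have gc (i : interval R) : {within [set` i], continuous g}.
  by apply: derivable_within_continuous => s _; have [] := gd s.
have [t0|t0] := leP 0 t.
  have [c + e] := MVT_segment t0 (fun s _ => gd s) (gc _).
  rewrite in_itv/= => /andP[c0 ct]; exists c; last by rewrite e subr0.
  by rewrite !ger0_norm.
have [c + e] := MVT_segment (ltW t0) (fun s _ => gd s) (gc _).
rewrite in_itv/= => /andP[tc c0]; exists c; first by rewrite !ler0_norm ?lerN2// ltW.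
by rewrite -opprB e sub0r mulrN opprK.
Qed.

Lemma is_derive_line (V : normedModType R) (f : V -> R) p v (s : R) :
  derivable f (p + s *: v) v ->
  is_derive s 1 (fun s => f (p + s *: v)) ('D_v f (p + s *: v)).
Proof.
move=> df; have E : (fun h : R => h^-1 *: (((fun s => f (p + s *: v)) \o shift s) (h *: 1)
    - f (p + s *: v))) =
    (fun h : R => h^-1 *: ((f \o shift (p + s *: v)) (h *: v) - f (p + s *: v))).
  apply/funext => h /=; congr (_ *: (f _ - _)).
  by rewrite scalerDl [h *: 1]mulr1 addrCA addrC addrAC addrC.
by apply: DeriveDef; rewrite /derivable /derive E.
Qed.

(** [dern] differentiates first along the last vector of its list, hence the [rcons]. *)
Lemma smooth_dern (V : normedModType R) (f : V -> R) v : smooth f -> smooth ('D_v f).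
Proof. by move=> sf vs; have := sf (rcons vs v); rewrite /dern foldr_rcons. Qed.

Lemma smooth_continuous (V : normedModType R) (f : V -> R) : smooth f -> continuous f.
Proof. by move=> /(_ [::])[]. Qed.

Lemma smooth_derivable (V : normedModType R) (f : V -> R) x v : smooth f -> derivable f x v.
Proof. by move=> /(_ [::])[_]; apply. Qed.

Lemma compact_support_derive (V : normedModType R) (f : V -> R) v :
  compact_support f -> compact_support ('D_v f).
Proof.
move=> [M fM]; exists M => p pM; rewrite /derive; apply/cvg_lim => //.
apply: cvg_near_cst; have : \forall h \near (0 : R)^', M < `|h *: v + p|.
  have c : `|h *: v + p| @[h --> (0 : R)^'] --> `|0 *: v + p|.
    apply: cvg_norm; apply: cvgD; last exact: cvg_cst.
    by apply: cvgZr_tmp; exact: nbhs_dnbhs.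
  by apply: (cvgr_gt _ c); rewrite scale0r add0r.
by apply: filterS => h hM; rewrite /= (fM _ pM) fM// subrr scaler0.
Qed.

(** Walk from 0 to [q] changing one coordinate at a time; in the sup norm the whole path stays in
    the ball of radius [r]. The restriction to a ball matters for [second_difference], where [K] is
    itself proportional to the radius. *)
Lemma coordwise_lipschitz n (F : 'rV[R]_n -> R) r K : 0 <= K ->
  (forall i p t, `|p| <= r -> `|p + t *: delta_mx ord0 i| <= r ->
    `|F (p + t *: delta_mx ord0 i) - F p| <= K * `|t|) ->
  forall q, `|q| <= r -> `|F q - F 0| <= n%:R * K * `|q|.
Proof.
move=> K0 FK q qr.
pose z (j : nat) : 'rV[R]_n := \row_i (if (i < j)%N then q ord0 i else 0).
have zr j : `|z j| <= r.
  apply: le_trans qr; rewrite norm_row_le//; apply/forallP => i; rewrite mxE.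
  by case: ifP => _; [exact: coord_le_norm|rewrite normr0].
have zS (j : 'I_n) : z j.+1 = z j + q ord0 j *: delta_mx ord0 j.
  apply/rowP => i; rewrite !mxE eqxx /= ltnS leq_eqVlt -(inj_eq val_inj)/=.
  by case: eqVneq => [/val_inj ->|_]; rewrite /= ?ltnn ?mulr1 ?mulr0 ?addr0 ?add0r.
have z0 : z 0%N = 0 by apply/rowP => i; rewrite !mxE.
have zn : z n = q by apply/rowP => i; rewrite !mxE ltn_ord.
rewrite -{1}zn -z0 -(telescope_sumr (fun j => F (z j)))// big_mkord.
apply: le_trans (ler_norm_sum _ _ _) _.
apply: (@le_trans _ _ (\sum_(i < n) K * `|q|)).
  apply: ler_sum => j _; rewrite zS.
  apply: le_trans (FK _ _ _ _ _) _; rewrite -?zS//.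
  by rewrite ler_wpM2l// coord_le_norm.
by rewrite sumr_const card_ord -mulrA mulr_natl.
Qed.

(** Two uses of [coordwise_lipschitz] with the mean value theorem replace a Taylor expansion: first
    for the partial derivatives, then for the even sum, whose value at 0 is twice the vanishing
    diagonal value. *)
Lemma second_difference n (Phi : 'rV[R]_n * 'rV[R]_n -> R) :
  smooth Phi -> compact_support Phi -> (forall x, Phi (x, x) = 0) ->
  exists2 D, 0 <= D & forall x z, `|Phi (x, x + z) + Phi (x, x - z)| <= D * `|z| ^+ 2.
Proof.
move=> sP kP P0.
pose v (i : 'I_n) : 'rV[R]_n * 'rV[R]_n := (0, delta_mx ord0 i).
have Pb (u : 'I_n * 'I_n) : exists c, 0 <= c /\
    forall p, `|'D_(v u.2) ('D_(v u.1) Phi) p| <= c.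
  have [|||c c0 cP] := @compact_support_bounded R _ _ ('D_(v u.2) ('D_(v u.1) Phi)).
  - exact: row_pair_ball_compact.
  - by apply/smooth_continuous/smooth_dern/smooth_dern.
  - by do 2 apply: compact_support_derive.
  by exists c.
have [C CP] := choice Pb.
have C0 u : 0 <= C u by have [] := CP u.
have PC u p : `|'D_(v u.2) ('D_(v u.1) Phi) p| <= C u by have [_] := CP u; apply.
pose C2 := \sum_u C u.
have C20 : 0 <= C2 by apply: sumr_ge0.
have PC2 i j p : `|'D_(v j) ('D_(v i) Phi) p| <= C2.
  by apply: le_trans (PC (i, j) p) _; rewrite /C2 (bigD1 (i, j))//= lerDl sumr_ge0.
have line x q (s : R) i : (x, q + s *: delta_mx ord0 i) = (x, q) + s *: v i.
  by congr pair; rewrite /= scaler0 addr0.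
have lip1 i x xi : `|'D_(v i) Phi (x, x + xi) - 'D_(v i) Phi (x, x)| <= n%:R * C2 * `|xi|.
  have := @coordwise_lipschitz n (fun xi => 'D_(v i) Phi (x, x + xi)) `|xi| C2 C20.
  rewrite addr0; apply=> // j p t _ _; rewrite addrA line.
  have [|c _ e] := @mvt_abs (fun s => 'D_(v i) Phi ((x, x + p) + s *: v j))
      (fun s => 'D_(v j) ('D_(v i) Phi) ((x, x + p) + s *: v j)) t.
    by move=> s; apply: is_derive_line; exact/smooth_derivable/smooth_dern.
  by move: e; rewrite scale0r addr0 => ->; rewrite normrM ler_wpM2r.
(* Each of the two increments of the partial derivative costs 3 |z|, since |p|, |q| <= |z| and |c|
   <= |t| <= 2 |z|; 8 exceeds the required 6. *)
exists (n%:R * (8 * n%:R * C2)) => [|x z]; first by rewrite !mulr_ge0.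
suff L : forall q, `|q| <= `|z| ->
    `|(Phi (x, x + q) + Phi (x, x - q)) - (Phi (x, x + 0) + Phi (x, x - 0))| <=
    n%:R * (8 * n%:R * C2 * `|z|) * `|q|.
  by have := L z (lexx _); rewrite subr0 addr0 P0 addr0 subr0 expr2 !mulrA.
apply: (@coordwise_lipschitz n (fun q => Phi (x, x + q) + Phi (x, x - q))).
  by rewrite !mulr_ge0.
move=> i p t pz ptz.
pose e : 'rV[R]_n := delta_mx ord0 i.
(* With this [q] one has q + t e = -p, so the change of the even sum is the increment of a
   difference whose two terms both move along +e. Its derivative compares one partial derivative at
   two points. *)
pose q := - (p + t *: e).
have [|c ct ec] := @mvt_abs
   (fun s => Phi ((x, x + p) + s *: v i) - Phi ((x, x + q) + s *: v i))
   (fun s => 'D_(v i) Phi ((x, x + p) + s *: v i) - 'D_(v i) Phi ((x, x + q) + s *: v i)) t.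
  by move=> s; apply: is_deriveB; apply: is_derive_line; exact: smooth_derivable.
have -> : Phi (x, x + (p + t *: delta_mx ord0 i)) + Phi (x, x - (p + t *: delta_mx ord0 i)) -
    (Phi (x, x + p) + Phi (x, x - p)) =
    (Phi ((x, x + p) + t *: v i) - Phi ((x, x + q) + t *: v i)) -
    (Phi ((x, x + p) + 0 *: v i) - Phi ((x, x + q) + 0 *: v i)).
  rewrite scale0r !addr0 -!line /q -!addrA opprD -[- _ - _ + _]addrA addNr addr0.
  by rewrite !opprD; ring.
rewrite ec normrM -!line -!addrA; apply: ler_wpM2r => //.
have te : `|t| <= 2 * `|z|.
  have -> : `|t| = `|(t *: e) ord0 i| by rewrite !mxE !eqxx mulr1.
  apply: le_trans (coord_le_norm _ _) _.
  rewrite -(addrK p (t *: e)) addrC (addrC (t *: e)); apply: le_trans (ler_normD _ _) _.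
  by rewrite normrN mulr2n mulrDl mul1r lerD.
have ne s : `|s *: e| <= `|s|.
  rewrite norm_row_le//; apply/forallP => j; rewrite !mxE eqxx/= normrM.
  by rewrite ler_piMr// ger0_norm ?lern1 ?leq_b1.
have b1 : `|p + c *: e| <= 3 * `|z|.
  apply: le_trans (ler_normD _ _) _; have := ne c; lra.
have qz : `|q| <= `|z| by rewrite normrN.
have b2 : `|q + c *: e| <= 3 * `|z|.
  apply: le_trans (ler_normD _ _) _; have := ne c; lra.
have l1 := lip1 i x (p + c *: e); have l2 := lip1 i x (q + c *: e).
have nC : 0 <= n%:R * C2 by rewrite mulr_ge0.
rewrite -(subrKA ('D_(v i) Phi (x, x))).
apply: le_trans (ler_normD _ _) _; rewrite (distrC ('D_(v i) Phi (x, x))).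
have z0 : 0 <= n%:R * C2 * `|z| by rewrite mulr_ge0.
apply: (le_trans (lerD (le_trans l1 (ler_wpM2l nC b1)) (le_trans l2 (ler_wpM2l nC b2)))).
by move: z0; lra.
Qed.

End Derivatives.

(** * The divergence on lattice points *)

Lemma tent_continuous (R : realType) (V : normedModType R) (a : V) (h : R) :
  continuous (fun x => Num.max 0 (1 - `|x - a| / h) : R).
Proof.
pose f (x : V) : R := 1 - `|x - a| / h.
have fc (x : V) : f y @[y --> x] --> f x.
  apply: cvgB; first exact: cvg_cst.
  apply: cvgM; last exact: cvg_cst.
  by apply: cvg_norm; apply: cvgB; [exact: cvg_id|exact: cvg_cst].
have -> : (fun x => Num.max 0 (1 - `|x - a| / h)) = (fun x => (0 + f x + `|0 - f x|) / 2).
  by apply/funext => x; rewrite maxr_absE.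
move=> x; have c0 : (fun=> 0 : R) @ x --> (0 : R) by exact: cvg_cst.
have c1 : (fun y => 0 + f y + `|0 - f y|) @ x --> 0 + f x + `|0 - f x|.
  by apply: cvgD; [exact: cvgD c0 (fc x)|apply: cvg_norm; exact: cvgB c0 (fc x)].
by apply: cvgM => //; exact: cvg_cst.
Qed.

Section LatticePoints.
Variables (R : realType) (n : nat).

Lemma notin_box_norm b (h : R) (k : 'rV[int]_n) : 0 < h -> k \notin box n b ->
  h * b.+1%:R <= `|hpt h k|.
Proof.
move=> h0; rewrite mem_box negb_forall => /existsP[i]; rewrite -ltnNge => bi.
apply: le_trans (coord_le_norm _ i).
by rewrite mxE normrM (gtr0_norm h0) ler_pM2l// -intr_norm -natr_absz ler_nat.
Qed.

Lemma cellP (h : R) (x y : 'rV[R]_n) i : 0 < h ->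
  0 <= (y - x) ord0 i - hpt h (cell x h y) ord0 i <= h.
Proof.
move=> h0; rewrite !mxE; have /andP[] := floor_itv ((y ord0 i - x ord0 i) / h).
rewrite ler_pdivlMr// ltr_pdivrMr// intrD => i1 i2.
by apply/andP; split; lra.
Qed.

Lemma cell_norm (h : R) (x y : 'rV[R]_n) : 0 < h ->
  `|(y - x) - hpt h (cell x h y)| <= h.
Proof.
move=> h0; rewrite norm_row_le ?(ltW h0)//; apply/forallP => i.
have := cellP x y i h0; rewrite !mxE => /andP[i1 i2].
by rewrite ger0_norm.
Qed.

Lemma Qfun_cell (h : R) (psi : 'rV[int]_n -> R) x : 0 < h ->
  Qfun h psi x = psi (cell 0 h x).
Proof.
move=> h0; have cubeE k : cube h k x -> k = cell 0 h x.
  move=> kx; apply/rowP => i; have /andP[i1 i2] := kx i.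
  apply/esym/eqP; rewrite !mxE subr0 floor_eq intrD ler_pdivlMr// ltr_pdivrMr//.
  by apply/andP; split; lra.
rewrite /Qfun -(fsbig_widen [set cell 0 h x]) //=; last first.
  move=> k [_ /= kx]; rewrite indicE memNset ?mulr0// => /cubeE; exact: kx.
rewrite fsbig_set1 indicE mem_set ?mulr1// => i.
have := cellP 0 x i h0; rewrite subr0 !mxE subr0.
have /andP[] := floor_itv (x ord0 i / h).
rewrite ler_pdivlMr// ltr_pdivrMr// intrD => i1 i2 _.
by apply/andP; split; lra.
Qed.

(** Distinct lattice points are at sup distance at least h, so a tent of radius h sees only its own
    lattice point. *)
Definition bump (h : R) (k : 'rV[int]_n) (x : 'rV[R]_n) : R :=
  Num.max 0 (1 - `|x - hpt h k| / h).

Lemma bump_hpt h k k' : 0 < h -> bump h k (hpt h k') = (k' == k)%:R.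
Proof.
move=> h0; rewrite /bump; case: eqVneq => [->|kk].
  by rewrite subrr normr0 mul0r subr0 max_r.
rewrite max_l// subr_le0 ler_pdivlMr// mul1r -hptN -hptD.
by rewrite hpt_norm_ge// subr_eq0.
Qed.

Lemma bump_continuous h k : continuous (bump h k).
Proof.
exact: tent_continuous.
Qed.

Lemma bump_compact_support h k : 0 < h -> compact_support (bump h k).
Proof.
move=> h0; exists (`|hpt h k| + h) => x xM; rewrite /bump max_l// subr_le0.
rewrite ler_pdivlMr// mul1r; have := lerB_dist x (hpt h k); lra.
Qed.

End LatticePoints.

Section KirchhoffDivergence.
Variables (R : realType) (n : nat) (alpha : R) (Phi : 'rV[R]_n * 'rV[R]_n -> R) (M : R).
Hypothesis Phi_supp : forall p, M < `|p| -> Phi p = 0.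

Lemma Phi_far x z : 2 * M < `|z| -> Phi (x, x + z) = 0.
Proof.
move=> zM; apply: Phi_supp; rewrite prod_normE /= lt_max.
have [//|xM] := ltP M `|x|; have [//|xzM] := ltP M `|x + z|.
have := ler_normB (x + z) x; rewrite addrAC subrr add0r; lra.
Qed.

Lemma divergence_formula h b (psi : 'rV[int]_n -> R) : 0 < h -> 2 * M < h * b.+1%:R ->
  (forall phi : 'rV[R]_n -> R, continuous phi -> compact_support phi ->
    intTh h phi psi = intSh alpha h (fun x y => phi x * Phi (x, y))) ->
  forall k, psi k = h ^+ n * \sum_(j <- box n b | j != 0)
    (Phi (hpt h k, hpt h k + hpt h j) / enorm (hpt h j) `^ (n%:R + alpha)).
Proof.
move=> h0 hb Hpsi k.
have := Hpsi _ (@bump_continuous R n h k) (@bump_compact_support R n h k h0).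
rewrite /intTh /intSh -(fsbig_widen [set k])//=; last first.
  by move=> k' [_ /= /eqP kk]; rewrite bump_hpt// (negbTE kk) mul0r mulr0.
rewrite fsbig_set1 bump_hpt// eqxx mul1r.
(* Off this list a term vanishes either through the bump, when the first index is not [k], or
   through [Phi], when the displacement leaves the box. *)
pose s := [seq (k, k + j) | j <- box n b & j != 0].
rewrite -(fsbig_widen [set` s]); first last.
- move=> [k' l] [/= kl /negP nkl]; rewrite bump_hpt//; case: eqVneq => [kk|_]; last first.
    by rewrite !mul0r mulr0 mul0r.
  move: kl nkl; rewrite {k'}kk => kl nkl; rewrite -[l](subrK k) addrC hptD Phi_far ?mulr0 ?mul0r//.
  apply: lt_le_trans hb (notin_box_norm h0 _); apply: contra nkl => lb.
  apply/mapP; exists (l - k); last by rewrite addrC subrK.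
  by rewrite mem_filter lb subr_eq0 eq_sym kl.
- move=> [k' l] /mapP[j]; rewrite mem_filter => /andP[j0 _] [-> ->] /=.
  by rewrite -subr_eq0 opprD addNKr oppr_eq0.
rewrite -fsbig_seq; last first.
  rewrite map_inj_uniq ?filter_uniq ?box_uniq// => i j [] /addrI; exact.
rewrite /s big_map big_filter => e; apply: (@mulfI _ (h ^+ n)); first by rewrite expf_neq0// gt_eqF.
rewrite e mulrA -exprD addnn -mul2n mulr_sumr; apply: eq_bigr => j _ /=.
by rewrite bump_hpt// eqxx mul1r hptD opprD addNKr enormN mulrA.
Qed.

End KirchhoffDivergence.

(** * The truncated kernel *)

Section ContinuityFacts.
Variable R : realType.

Lemma powR_continuous_at (x p : R) : 0 < x -> {for x, continuous (fun y : R => y `^ p)}.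
Proof.
move=> x0; apply/differentiable_continuous/derivable1_diffP.
by apply: derivable_powR; rewrite in_itv/= x0.
Qed.

Lemma truncated_quotient_continuous (T : topologicalType) (F E : T -> R) (eps p : R) :
  0 < eps -> continuous F -> continuous E ->
  continuous (fun u => F u / (Num.max (E u) eps) `^ p).
Proof.
move=> e0 cF cE u.
have cm : (fun v => Num.max (E v) eps) @ u --> Num.max (E u) eps.
  have -> : (fun v => Num.max (E v) eps) = (fun v => (E v + eps + `|E v - eps|) / 2).
    by apply/funext => v; rewrite maxr_absE.
  rewrite maxr_absE.
  have c1 : (fun=> eps) @ u --> eps by exact: cvg_cst.
  have c2 : (fun v => E v + eps + `|E v - eps|) @ u --> E u + eps + `|E u - eps|.
    by apply: cvgD; [exact: cvgD (cE u) c1|apply: cvg_norm; exact: cvgB (cE u) c1].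
  by apply: cvgM => //; exact: cvg_cst.
have m0 : 0 < Num.max (E u) eps by rewrite lt_max e0 orbT.
apply: cvgM; first exact: cF.
apply: cvgV; first by rewrite gt_eqF// powR_gt0.
exact: (cvg_comp _ _ cm (powR_continuous_at m0)).
Qed.

Lemma sqrt_sumsqr_continuous (T : topologicalType) n (f : 'I_n -> T -> R) :
  (forall i, continuous (f i)) -> continuous (fun t => Num.sqrt (\sum_i f i t ^+ 2)).
Proof.
move=> cf t.
have cs : (fun t => \sum_i f i t ^+ 2) @ t --> \sum_i f i t ^+ 2.
  apply: (@cvg_big _ _ _ _ _ _ _ _ _ (fun i t => f i t ^+ 2)).
  - exact: add_continuous.
  - by move=> i _; rewrite expr2; under eq_fun do rewrite expr2; apply: cvgM; exact: cf.
exact: (cvg_comp _ _ cs (@sqrt_continuous R _)).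
Qed.

Lemma shift_pair_continuous (V : normedModType R) (F : V * V -> R) :
  continuous F -> continuous (fun u : V * V => F (u.1, u.1 + u.2)).
Proof.
move=> cF u.
have c : (fun u : V * V => (u.1, u.1 + u.2)) @ u --> (u.1, u.1 + u.2).
  apply: cvg_pair; first exact: cvg_fst.
  by apply: cvgD; [exact: cvg_fst|exact: cvg_snd].
exact: (cvg_comp _ _ c (cF _)).
Qed.

Lemma enorm_snd_continuous n : continuous (fun u : 'rV[R]_n * 'rV[R]_n => enorm u.2).
Proof.
apply: (@sqrt_sumsqr_continuous _ n (fun i (u : 'rV[R]_n * 'rV[R]_n) => u.2 ord0 i)) => i u.
apply: (@continuous_comp _ _ _ snd (fun x : 'rV[R]_n => x ord0 i)); first exact: cvg_snd.
exact: coord_continuous.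
Qed.

End ContinuityFacts.

Section TruncatedKernel.
Variables (R : realType) (n : nat) (alpha : R).
Variables (Phi : 'rV[R]_n * 'rV[R]_n -> R) (M : R).
Hypothesis Phi_supp : forall p, M < `|p| -> Phi p = 0.
Hypothesis Phi_cont : continuous Phi.

(** The kernel in the variables (x, y - x), with the distance frozen below [eps]. It is continuous
    with compact support, hence bounded and uniformly continuous; the jump at the sphere is carried
    by a separate 0/1 factor. *)
Definition truncated_kernel (eps : R) (u : 'rV[R]_n * 'rV[R]_n) : R :=
  Phi (u.1, u.1 + u.2) / (Num.max (enorm u.2) eps) `^ (n%:R + alpha).

Lemma truncated_kernel_continuous eps : 0 < eps -> continuous (truncated_kernel eps).
Proof.
move=> e0; apply: truncated_quotient_continuous => //.
  exact: shift_pair_continuous.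
exact: enorm_snd_continuous.
Qed.

Lemma truncated_kernel_compact_support eps : compact_support (truncated_kernel eps).
Proof.
(* The sign of [M] is not known here, so neither bound dominates the other. *)
exists (Num.max M (2 * M)) => -[x z]; rewrite prod_normE /= !lt_max !gt_max.
rewrite /truncated_kernel /= => /orP[/andP[xM _]|/andP[_ zM]].
  by rewrite Phi_supp ?mul0r// prod_normE /= lt_max xM.
by rewrite (Phi_far Phi_supp x zM) mul0r.
Qed.

Lemma truncated_kernelE eps x z : eps < enorm z ->
  truncated_kernel eps (x, z) = Phi (x, x + z) / enorm z `^ (n%:R + alpha).
Proof. by move=> ez; rewrite /truncated_kernel/= max_l// ltW. Qed.

End TruncatedKernel.

Lemma sqnorm_perturb (R : realType) n (z w : 'rV[R]_n) (B h : R) : `|z| <= B -> `|w| <= h ->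
  `|enorm (z + w) ^+ 2 - enorm z ^+ 2| <= n%:R * (h * (2 * B + h)).
Proof.
move=> zB wh; rewrite !enorm_sqr -sumrB; apply: le_trans (ler_norm_sum _ _ _) _.
apply: (@le_trans _ _ (\sum_(i < n) (h * (2 * B + h)))); last by rewrite sumr_const card_ord -[leLHS]mulr_natl.
apply: ler_sum => i _; rewrite mxE.
have zi := le_trans (coord_le_norm z i) zB; have wi := le_trans (coord_le_norm w i) wh.
have -> : (z ord0 i + w ord0 i) ^+ 2 - z ord0 i ^+ 2 = w ord0 i * (2 * z ord0 i + w ord0 i) by ring.
rewrite normrM; apply: ler_pM => //; apply: le_trans (ler_normD _ _) _.
by rewrite normrM ger0_norm//; lra.
Qed.

(** * Lattice sums against truncated integrals *)

Section MainEstimate.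
Variables (R : realType) (n : nat) (alpha : R).
Variables (Phi : 'rV[R]_n.+1 * 'rV[R]_n.+1 -> R) (M : R).
Hypotheses (alpha02 : 0 < alpha < 2) (M0 : 0 <= M).
Hypothesis Phi_supp : forall p, M < `|p| -> Phi p = 0.
Hypothesis Phi_diag : forall x, Phi (x, x) = 0.

(* One unit more than [2 * M / h], because the cells of negative index lie
   closer to the origin than the grid point labelling them. *)
Definition mesh (h : R) : nat := (Num.truncn (2 * M / h)).+1.

(** With h mesh <= 2 M + 1 and h <= 1, this bounds the side h (2 mesh + 1) of the box; the same
    number bounds the factor 2 B + h of [sqnorm_perturb] for B = 2 M + 1. *)
Definition width : R := 4 * M + 3.

Lemma width_gt0 : 0 < width.
Proof. by move: M0; rewrite /width; lra. Qed.

Lemma meshP h : 0 < h <= 1 ->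
  [/\ 2 * M < h * (mesh h)%:R, h * (mesh h)%:R <= 2 * M + 1 &
      h * (2 * mesh h + 1)%:R <= width].
Proof.
case/andP=> h0 h1; have m0 : 0 <= 2 * M / h by rewrite divr_ge0 ?mulr_ge0// ltW.
have /andP[] := truncn_itv m0; rewrite ler_pdivlMr// ltr_pdivrMr// => t1 t2.
have e : (mesh h)%:R = (Num.truncn (2 * M / h))%:R + 1 :> R by rewrite /mesh -natr1.
have m2 : h * (mesh h)%:R <= 2 * M + 1 by rewrite e; lra.
split => //; first by rewrite [ltRHS]mulrC; exact: t2.
by move: m2 h1; rewrite natrD natrM /width; set m := (mesh h)%:R; lra.
Qed.

Lemma average_le h c (a : 'rV[int]_n.+1 -> R) : 0 < h <= 1 -> 0 <= c ->
  (forall j, `|a j| <= c) ->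
  `|h ^+ n.+1 * \sum_(j <- box n.+1 (mesh h)) a j| <= width ^+ n.+1 * c.
Proof.
move=> h01 c0 ac; have [_ _ hW] := meshP h01; have /andP[h0 _] := h01.
rewrite normrM ger0_norm ?exprn_ge0 ?(ltW h0)//.
apply: (@le_trans _ _ (h ^+ n.+1 * \sum_(j <- box n.+1 (mesh h)) c)).
  rewrite ler_wpM2l ?exprn_ge0 ?(ltW h0)//; apply: le_trans (ler_norm_sum _ _ _) _.
  by apply: ler_sum => j _; exact: ac.
rewrite big_const_seq count_predT size_box iter_addr_0 -[X in _ * X]mulr_natl.
rewrite mulrA; apply: ler_wpM2r => //; rewrite natrX -exprMn.
by apply: lerXn2r; rewrite ?nnegrE ?(ltW width_gt0)// mulr_ge0// ltW.
Qed.

Definition cutoff_sum (eps h : R) (x : 'rV[R]_n.+1) : R :=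
  h ^+ n.+1 * \sum_(j <- box n.+1 (mesh h))
    (eps < enorm (hpt h j))%R%:R * truncated_kernel alpha Phi eps (x, hpt h j).

Definition cutoff_integral (eps : R) (x : 'rV[R]_n.+1) : R :=
  iint (fun y => \1_([set y | eps < enorm (x - y)]) y *
    ((Phi (x, y) - Phi (x, x)) / enorm (x - y) `^ (n.+1%:R + alpha))).

Lemma cutoff_sum_bound eps h C x : 0 < h <= 1 -> 0 <= C ->
  (forall u, `|truncated_kernel alpha Phi eps u| <= C) ->
  `|cutoff_sum eps h x| <= width ^+ n.+1 * C.
Proof.
move=> h01 C0 tC; apply: average_le => // j; rewrite normrM ger0_norm//.
by case: (_ < _)%R; rewrite ?mul1r ?mul0r.
Qed.

Lemma cutoff_sum_dist eps h om x x' : 0 < h <= 1 -> 0 <= om ->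
  (forall u u', `|u - u'| <= h ->
    `|truncated_kernel alpha Phi eps u - truncated_kernel alpha Phi eps u'| <= om) ->
  `|x - x'| <= h -> `|cutoff_sum eps h x - cutoff_sum eps h x'| <= width ^+ n.+1 * om.
Proof.
move=> h01 om0 uc xx; rewrite -mulrBr -sumrB; apply: average_le => // j.
rewrite -mulrBr normrM ger0_norm//; case: (_ < _)%R; rewrite ?mul1r ?mul0r//.
apply: uc; rewrite prod_normE /= subrr normr0 ge_max xx.
by rewrite (le_trans _ xx).
Qed.

Lemma cutoff_integral_near eps h om C x : 0 < h <= 1 -> 0 < eps -> 0 <= om -> 0 <= C ->
  (forall u, `|truncated_kernel alpha Phi eps u| <= C) ->
  (forall u u', `|u - u'| <= h ->
    `|truncated_kernel alpha Phi eps u - truncated_kernel alpha Phi eps u'| <= om) ->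
  `|cutoff_integral eps x - cutoff_sum eps h x| <=
  width ^+ n.+1 * om +
  C * (width ^+ n * (2 * (Num.sqrt (2 * (n.+1%:R * width) * h) + h))).
Proof.
move=> h01 e0 om0 C0 tC uc; have [hb1 hb2 hW] := meshP h01.
have /andP[h0 h1] := h01; pose Lc : R := n.+1%:R * width.
have Lc0 : 0 <= Lc by rewrite mulr_ge0// ltW ?width_gt0.
(* Inside a cell the squared Euclidean norm differs from that of the lattice point by at most Lc h.
   A cell crossed by the sphere thus has h^2 sqnorm within Lc h of eps^2; dividing by h^2 gives a
   window of length [l]. *)
pose A := (eps ^+ 2 - Lc * h) / h ^+ 2; pose l := 2 * Lc / h.
have l0 : 0 <= l by apply: divr_ge0; [exact: mulr_ge0|exact: ltW].
pose b := mesh h.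
pose e (j : 'rV[int]_n.+1) := om + C * (A <= sqnorm R j <= A + l)%R%:R.
pose tk z := truncated_kernel alpha Phi eps (x, z).
pose f (y : 'rV[R]_n.+1) := \1_([set y | eps < enorm (x - y)]) y *
    ((Phi (x, y) - Phi (x, x)) / enorm (x - y) `^ (n.+1%:R + alpha)).
have fE y : f y = (eps < enorm (y - x))%R%:R * tk (y - x).
  rewrite /f indicE Phi_diag subr0 -[x - y]opprB enormN.
  have -> : (y \in [set y | eps < enorm (x - y)]) = (eps < enorm (y - x)).
    by apply/idP/idP; rewrite ?inE /= -[x - y]opprB enormN.
  have [ez|_] := ltP eps (enorm (y - x)); last by rewrite !mul0r.
  by rewrite /tk truncated_kernelE// (addrC x) subrK.
have main : `|iint f - cutoff_sum eps h x| <= h ^+ n.+1 * \sum_(j <- box n.+1 b) e j.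
  apply: (iint_riemann (x := x)
    (c := fun j => (eps < enorm (hpt h j))%R%:R * tk (hpt h j)) h0) => y.
    set j := cell x h y => jb; rewrite fE.
    set z := y - x; pose w := z - hpt h j.
    have zE : z = hpt h j + w by rewrite /w addrC subrK.
    have wh : `|w| <= h by exact: cell_norm.
    have jB : `|hpt h j| <= 2 * M + 1.
      apply: le_trans hb2; rewrite norm_row_le ?mulr_ge0 ?(ltW h0)//.
      apply/forallP => i; rewrite mxE normrM (gtr0_norm h0) ler_pM2l//.
      move: jb; rewrite mem_box => /forallP/(_ i).
      by rewrite -intr_norm -natr_absz ler_nat.
    have := sqnorm_perturb jB wh; rewrite -zE enorm_hpt_sqr => pert.
    have {}pert : `|enorm z ^+ 2 - h ^+ 2 * sqnorm R j| <= Lc * h.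
      apply: le_trans pert _; rewrite /Lc -mulrA ler_wpM2l// [leRHS]mulrC ler_wpM2l ?(ltW h0)//.
      by rewrite /width; lra.
    have h20 : 0 < h ^+ 2 by rewrite exprn_gt0.
    have annulus : eps ^+ 2 - Lc * h <= h ^+ 2 * sqnorm R j <= eps ^+ 2 + Lc * h ->
        (A <= sqnorm R j <= A + l).
      move=> /andP[s1 s2]; rewrite /A ler_pdivrMr// (mulrC (sqnorm R j)) s1 /=.
      have -> : (eps ^+ 2 - Lc * h) / h ^+ 2 + l = (eps ^+ 2 + Lc * h) / h ^+ 2.
        by rewrite /l; field; rewrite gt_eqF.
      by rewrite ler_pdivlMr// (mulrC (sqnorm R j)).
    have sq (a c : R) : 0 <= a -> 0 <= c -> (a ^+ 2 <= c ^+ 2) = (a <= c).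
      by move=> a0 c0; rewrite ler_pXn2r.
    have ez := enorm_ge0 z; have ej := enorm_ge0 (hpt h j).
    have ejE := enorm_hpt_sqr h j.
    move: pert; rewrite ler_norml => /andP[p1 p2].
    (* On the same side of the sphere the modulus of continuity suffices; on opposite sides a single
       term survives, it is at most [C], and the index lies in the annulus. *)
    rewrite /e; have [e1|e1] := ltP eps (enorm z); have [e2|e2] := ltP eps (enorm (hpt h j)).
    - rewrite !mul1r; apply: le_trans (uc _ _ _) _; last by rewrite lerDl mulr_ge0.
      by rewrite prod_normE /= subrr normr0 ge_max wh (ltW h0).
    - rewrite mul1r mul0r subr0 annulus ?mulr1; last first.
        move: (ltW e1) e2; rewrite -sq ?(ltW e0)// -(sq _ eps) ?(ltW e0)// ejE => e1' e2'.
        by apply/andP; split; lra.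
      by apply: le_trans (tC _) _; rewrite lerDr.
    - rewrite mul1r mul0r sub0r normrN annulus ?mulr1; last first.
        move: (ltW e2) e1; rewrite -sq ?(ltW e0)// -(sq _ eps) ?(ltW e0)// ejE => e1' e2'.
        by apply/andP; split; lra.
      by apply: le_trans (tC _) _; rewrite lerDr.
    - by rewrite !mul0r subr0 normr0 addr_ge0// mulr_ge0.
  move=> jb; rewrite fE /tk /truncated_kernel /= (Phi_far Phi_supp) ?mul0r ?mulr0//.
  apply: lt_le_trans hb1 _.
  have := notin_box_norm h0 jb; have := cell_norm x y h0.
  have := ler_normB (y - x) (y - x - hpt h (cell x h y)).
  rewrite opprB addrC addrNK -natr1; rewrite -/b.
  lra.
apply: le_trans main _; rewrite /e big_split/= mulrDr; apply: lerD.
  have := average_le h01 om0 (a := fun=> om).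
  by rewrite ger0_norm// => /(_ (fun=> lexx _)); apply: le_trans; exact: ler_norm.
rewrite -mulr_sumr mulrCA; apply: ler_wpM2l => //.
apply: le_trans (ler_wpM2l (exprn_ge0 _ (ltW h0)) (count_annulus n b A l0)) _.
(* Of the n + 1 factors h, n keep the number of lines bounded and the last one multiplies sqrt l +
   1; as [l] is of order 1/h, the result is of order h^(1/2). *)
rewrite exprSr -mulrA [leLHS](_ : _ = (h * (2 * b + 1)%:R) ^+ n * (2 * (h * Num.sqrt l + h))); last first.
  by rewrite exprMn; ring.
have -> : h * Num.sqrt l = Num.sqrt (2 * (n.+1%:R * width) * h).
  rewrite -{1}[h]gtr0_norm// -sqrtr_sqr -sqrtrM ?sqr_ge0//; congr Num.sqrt.
  by rewrite /l /Lc; field; rewrite gt_eqF.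
apply: ler_wpM2r.
  by rewrite mulr_ge0// addr_ge0 ?sqrtr_ge0// ltW.
by apply: lerXn2r; rewrite ?nnegrE ?(ltW width_gt0)// mulr_ge0// ltW.
Qed.

(** Both sums run over the same box, so their difference is exactly the sum over nonzero
    displacements of length at most [eps]; no limit in h is taken. *)
Lemma divergence_near D eps h (psi : 'rV[int]_n.+1 -> R) k :
  0 < h <= 1 -> 0 < eps -> 0 <= D ->
  (forall x z, `|Phi (x, x + z) + Phi (x, x - z)| <= D * `|z| ^+ 2) ->
  (forall phi : 'rV[R]_n.+1 -> R, continuous phi -> compact_support phi ->
    intTh h phi psi = intSh alpha h (fun x y => phi x * Phi (x, y))) ->
  `|psi k - cutoff_sum eps h (hpt h k)| <= D * tail_const n.+1 alpha * eps `^ (2 - alpha).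
Proof.
move=> h01 e0 D0 PhiD Hpsi; have [hb1 _ _] := meshP h01; have /andP[h0 _] := h01.
have hb : 2 * M < h * (mesh h).+1%:R.
  by apply: lt_trans hb1 _; rewrite ltr_pM2l// ltr_nat.
rewrite (divergence_formula Phi_supp h0 hb Hpsi) (bigID (fun j => enorm (hpt h j) <= eps))/=.
have -> : \sum_(j <- box n.+1 (mesh h) | (j != 0) && ~~ (enorm (hpt h j) <= eps))
    (Phi (hpt h k, hpt h k + hpt h j) / enorm (hpt h j) `^ (n.+1%:R + alpha)) =
    \sum_(j <- box n.+1 (mesh h)) (eps < enorm (hpt h j))%R%:R *
      truncated_kernel alpha Phi eps (hpt h k, hpt h j).
  rewrite big_mkcond; apply: eq_bigr => j _; rewrite -ltNge.
  have [ej|_] := ltP eps (enorm (hpt h j)); last by rewrite andbF mul0r.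
  rewrite mul1r truncated_kernelE// andbT; case: eqVneq => // j0.
  move: ej; rewrite j0 hpt0 /enorm big1 ?sqrtr0 ?ltNge ?(ltW e0)// => i _.
  by rewrite mxE expr0n.
rewrite mulrDr addrK.
exact: (symmetric_tail alpha02 (mesh h) h0 e0 D0 (F := fun z => Phi (hpt h k, hpt h k + z))).
Qed.

End MainEstimate.

(** * Passage to the limit *)

Section Convergence.
Variables (R : realType) (n : nat) (alpha : R).
Variables (Phi : 'rV[R]_n.+1 * 'rV[R]_n.+1 -> R).
Variable psi : R -> 'rV[int]_n.+1 -> R.
Hypotheses (alpha02 : 0 < alpha < 2) (Phi_smooth : smooth Phi).
Hypothesis Phi_compact_support : compact_support Phi.
Hypothesis Phi_diag : forall x, Phi (x, x) = 0.
Hypothesis psi_divergence : forall h : R, 0 < h < 1 ->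
  forall phi : 'rV[R]_n.+1 -> R, continuous phi -> compact_support phi ->
    intTh h phi (psi h) = intSh alpha h (fun x y => phi x * Phi (x, y)).

Local Notation flap := (fraclap alpha (fun x y => Phi (x, y))).
Local Notation cutoff := (cutoff_integral alpha Phi).

Lemma Phi_support_ge0 : exists2 M, 0 <= M & forall p, M < `|p| -> Phi p = 0.
Proof.
have [M Phi_supp] := Phi_compact_support.
by exists `|M| => // p pM; apply: Phi_supp; apply: le_lt_trans (ler_norm _) pM.
Qed.

Lemma truncated_kernel_facts eps : 0 < eps ->
  continuous (truncated_kernel alpha Phi eps) /\
  compact_support (truncated_kernel alpha Phi eps).
Proof.
move=> e0; have [M _ Phi_supp] := Phi_support_ge0; split.
  by apply: truncated_kernel_continuous => //; exact: smooth_continuous.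
exact: (truncated_kernel_compact_support alpha Phi_supp eps).
Qed.

Lemma divergence_estimate : exists2 K, 0 <= K &
  (forall eps eta, 0 < eps -> 0 < eta -> exists2 h0, 0 < h0 <= 1 &
    forall h x, 0 < h < h0 ->
      `|psi h (cell 0 h x) - cutoff eps x| <= K * eps `^ (2 - alpha) + eta) /\
  exists2 B, 0 <= B & forall h k, 0 < h < 1 -> `|psi h k| <= B.
Proof.
have [M M0 Phi_supp] := Phi_support_ge0.
have [D D0 PhiD] := second_difference Phi_smooth Phi_compact_support Phi_diag.
set W := width M; have W0 : 0 < W by exact: width_gt0.
have WN0 : 0 < W ^+ n.+1 by exact: exprn_gt0.
pose K := D * tail_const n.+1 alpha.
have K0 : 0 <= K by rewrite mulr_ge0// ltW// tail_const_gt0.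
have ball_compact := @row_pair_ball_compact R n.+1 n.+1.
exists K => //; split; last first.
  (* For the uniform bound the single cutoff eps = 1 is enough. *)
  have [tkc tks] := truncated_kernel_facts ltr01.
  have [C C0 tC] := compact_support_bounded ball_compact tkc tks.
  exists (K + W ^+ n.+1 * C) => [|h k /andP[h0 h1]].
    by rewrite addr_ge0// mulr_ge0// ltW.
  have h01 : 0 < h <= 1 by rewrite h0 ltW.
  have := divergence_near alpha02 M0 Phi_supp k h01 ltr01 D0 PhiD
    (psi_divergence (h := h) (introT andP (conj h0 h1))).
  rewrite powR1 mulr1 -/K => near1.
  have := cutoff_sum_bound M0 (hpt h k) h01 C0 tC; rewrite -/W => near2.
  rewrite -(subrK (cutoff_sum alpha Phi M 1 h (hpt h k)) (psi h k)).
  by apply: le_trans (ler_normD _ _) _; exact: lerD.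
move=> eps eta e0 eta0.
have [tkc tks] := truncated_kernel_facts e0.
have [C C0 tC] := compact_support_bounded ball_compact tkc tks.
(* Budget for [eta]: one quarter for moving the base point from the lattice to [x], one quarter for
   the oscillation inside cells, one half for the cells near the sphere. The last share is [Q] times
   sqrt(2 Lc h) + h, where [r] and q/2 each keep one summand below q/2. The added 1s keep
   denominators positive. *)
pose om := eta / (4 * W ^+ n.+1).
have om0 : 0 < om by rewrite divr_gt0// mulr_gt0.
have [d d0 uc] := compact_support_unif_continuous ball_compact tkc tks om0.
pose Q := C * (W ^+ n * 2).
have Q0 : 0 <= Q by rewrite !mulr_ge0// exprn_ge0// ltW.
pose Lc : R := n.+1%:R * W.
have Lc0 : 0 <= Lc by rewrite mulr_ge0// ltW.
pose q := eta / (2 * (Q + 1)).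
have q0 : 0 < q by rewrite divr_gt0// mulr_gt0// ltr_wpDl.
pose r := (q / 2) ^+ 2 / (2 * Lc + 1).
have Lc1 : 0 < 2 * Lc + 1 by rewrite ltr_wpDl// mulr_ge0.
have r0 : 0 < r by apply: divr_gt0 => //; apply: exprn_gt0; exact: divr_gt0.
exists (Num.min 1 (Num.min d (Num.min (q / 2) r))).
  by rewrite !lt_min ltr01 d0 r0 divr_gt0//= ge_min lexx.
move=> h x /andP[h0]; rewrite !lt_min => /and4P[h1 hd hq hr].
have h01 : 0 < h <= 1 by rewrite h0 ltW.
have uch u u' : `|u - u'| <= h ->
    `|truncated_kernel alpha Phi eps u - truncated_kernel alpha Phi eps u'| <= om.
  by move=> uu; apply: uc; apply: le_trans uu (ltW hd).
set k := cell 0 h x.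
have near1 := divergence_near alpha02 M0 Phi_supp k h01 e0 D0 PhiD
  (psi_divergence (h := h) (introT andP (conj h0 h1))).
have xk : `|hpt h k - x| <= h.
  by rewrite distrC; have := cell_norm 0 x h0; rewrite subr0.
have near2 := cutoff_sum_dist M0 h01 (ltW om0) uch xk.
have near3 := cutoff_integral_near M0 Phi_supp Phi_diag x h01 e0 (ltW om0) C0 tC uch.
have om2 : W ^+ n.+1 * om = eta / 4 by rewrite /om; field; rewrite gt_eqF.
have sq : Num.sqrt (2 * Lc * h) <= q / 2.
  have q20 : 0 <= q / 2 by rewrite divr_ge0// ltW.
  rewrite -(ger0_norm q20) -sqrtr_sqr ler_wsqrtr//.
  move: hr; rewrite /r ltr_pdivlMr//.
  by have := ltW h0; lra.
have tail : C * (W ^+ n * (2 * (Num.sqrt (2 * Lc * h) + h))) <= eta / 2.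
  rewrite (_ : C * _ = Q * (Num.sqrt (2 * Lc * h) + h)); last by rewrite /Q; ring.
  apply: (@le_trans _ _ (Q * q)); first by rewrite ler_wpM2l//; lra.
  have Qq : (Q + 1) * q = eta / 2.
    by rewrite /q; field; rewrite gt_eqF// ltr_wpDl.
  by move: Qq q0; rewrite mulrDl mul1r; lra.
move: near1 near2 near3; rewrite -/K -/W om2 -/Lc => near1 near2 near3.
rewrite -(subrK (cutoff_sum alpha Phi M eps h (hpt h k)) (psi h k)) -addrA.
apply: le_trans (ler_normD _ _) _; apply: lerD => //.
rewrite -(subrK (cutoff_sum alpha Phi M eps h x) (cutoff_sum alpha Phi M eps h (hpt h k))).
rewrite -addrA; apply: le_trans (ler_normD _ _) _; rewrite (distrC _ (cutoff eps x)).
lra.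
Qed.

Lemma fraclap_uniform_limit eta : 0 < eta -> exists2 h0, 0 < h0 <= 1 &
  forall h x, 0 < h < h0 -> `|psi h (cell 0 h x) - flap x| <= eta.
Proof.
have [K K0 [est _]] := divergence_estimate; move=> eta0.
pose s := 2 - alpha; have s0 : 0 < s by case/andP: alpha02 => _; rewrite subr_gt0.
have small (e : R) : 0 < e -> \forall a \near (0 : R)^'+, K * a `^ s < e.
  move=> e0; have c : K * a `^ s @[a --> (0 : R)^'+] --> K * 0.
    by apply: cvgM; [exact: cvg_cst|exact: powR_cvg0].
  by apply: (cvgr_lt _ c); rewrite mulr0.
(* Both cutoffs are compared with [psi] at one common h, and the arbitrary slack [t] absorbs
   everything that depends on h. *)
have dist x e e' : 0 < e -> 0 < e' ->
    `|cutoff e x - cutoff e' x| <= K * e `^ s + K * e' `^ s.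
  move=> e0 e'0; apply/ler_addgt0Pr => t t0; have t20 : 0 < t / 2 by rewrite divr_gt0.
  have [h1 /andP[h10 _] H1] := est e (t / 2) e0 t20.
  have [h2 /andP[h20 _] H2] := est e' (t / 2) e'0 t20.
  pose h := Num.min h1 h2 / 2.
  have m0 : 0 < Num.min h1 h2 by rewrite lt_min h10.
  have hm : h < Num.min h1 h2 by rewrite ltr_pdivrMr// mulr2n mulrDr mulr1 ltrDl.
  move: hm; rewrite lt_min => /andP[hh1 hh2].
  have hp : 0 < h by rewrite divr_gt0.
  have := H1 h x; rewrite hp hh1 => /(_ isT) a1.
  have := H2 h x; rewrite hp hh2 => /(_ isT) a2.
  rewrite -(subrKA (psi h (cell 0 h x))); apply: le_trans (ler_normD _ _) _.
  rewrite (distrC (cutoff e x)); rewrite -/s in a1 a2; lra.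
have cutoff_cvg x : cvg (cutoff eps x @[eps --> (0 : R)^'+]).
  apply/cauchy_cvgP; apply: cauchy_exP => e e0.
  near (0 : R)^'+ => d; exists (cutoff d x).
  rewrite -ball_normE /=; suff : \forall a \near (0 : R)^'+, `|cutoff d x - cutoff a x| < e by [].
  near=> a.
  apply: le_lt_trans (dist _ _ _ _ _) _.
  - by near: d; exact: nbhs_right_gt.
  - by near: a; exact: nbhs_right_gt.
  rewrite [e]splitr; apply: ltrD.
  - by near: d; apply: (small); rewrite divr_gt0.
  - by near: a; apply: (small); rewrite divr_gt0.
(* Convergence being known, the limit may be taken in one of the two cutoffs of [dist]; the bound
   does not depend on [x]. *)
have flap_near x e : 0 < e -> `|flap x - cutoff e x| <= K * e `^ s.
  move=> e0; apply/ler_addgt0Pr => t t0; have t20 : 0 < t / 2 by rewrite divr_gt0.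
  near (0 : R)^'+ => a.
  have a0 : 0 < a by near: a; exact: nbhs_right_gt.
  have a1 : `|flap x - cutoff a x| < t / 2.
    by near: a; move/cvgrPdist_lt: (cutoff_cvg x); apply.
  have a2 : K * a `^ s < t / 2 by near: a; exact: (small _ t20).
  have a3 := dist x a e a0 e0.
  rewrite -(subrKA (cutoff a x)); apply: le_trans (ler_normD _ _) _; lra.
have [e [e0 es]] : exists e, 0 < e /\ K * e `^ s < eta / 4.
  near (0 : R)^'+ => e; exists e; split; near: e; first exact: nbhs_right_gt.
  by apply: (small); rewrite divr_gt0.
have eta20 : 0 < eta / 2 by rewrite divr_gt0.
have [h0 h01 H] := est e (eta / 2) e0 eta20; exists h0 => // h x /(H h x) a1.
have a2 := flap_near x e e0.
rewrite -(subrKA (cutoff e x)); apply: le_trans (ler_normD _ _) _.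
rewrite (distrC (cutoff e x)); rewrite -/s in a1; lra.
Unshelve. all: by end_near. Qed.

Lemma density_limit (phi : 'rV[R]_n.+1 -> R) :
  continuous phi -> compact_support phi ->
  (fun h : R => iint (fun x => Qfun h (psi h) x * phi x)) @ 0^'+
    --> iint (fun x => phi x * flap x).
Proof.
move=> cphi sphi; have [_ _ [_ [B B0 psiB]]] := divergence_estimate.
have [M' phiM'] := sphi; pose M := `|M'|.
have M0 : 0 <= M by exact: normr_ge0.
have phiM x : M < `|x| -> phi x = 0.
  by move=> xM; apply: phiM'; apply: le_lt_trans (ler_norm _) xM.
have ball_compact := @row_ball_compact R n.+1.
have [C C0 phiC] := compact_support_bounded ball_compact cphi sphi.
set W := width M; have W0 : 0 < W by exact: width_gt0.
have WN0 : 0 < W ^+ n.+1 by exact: exprn_gt0.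
apply/cvgrPdist_le => e e0.
pose om := e / (4 * W ^+ n.+1 * (B + 1)).
have om0 : 0 < om by rewrite divr_gt0// !mulr_gt0// ltr_wpDl.
pose eta := e / (4 * W ^+ n.+1 * (C + 1)).
have eta0 : 0 < eta by rewrite divr_gt0// !mulr_gt0// ltr_wpDl.
have [d d0 uc] := compact_support_unif_continuous ball_compact cphi sphi om0.
have [h1 /andP[h10 h11] unif] := fraclap_uniform_limit eta0.
near=> h.
have h0 : 0 < h by near: h; exact: nbhs_right_gt.
have hh1 : h < h1 by near: h; exact: nbhs_right_lt.
have hd : h < d by near: h; exact: nbhs_right_lt.
have hlt1 : h < 1 by exact: lt_le_trans hh1 h11.
have h01 : 0 < h <= 1 by rewrite h0 ltW.
have psihB k : `|psi h k| <= B by apply: psiB; rewrite h0.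
(* Error per cell: [C * eta] for replacing the limit by [psi], [B * om] for freezing the test
   function at the lattice point. The choices of [om] and [eta] make each part at most e/4 after
   multiplication by the volume bound. *)
pose E := C * eta + B * om.
have E0 : 0 <= E by rewrite addr_ge0// mulr_ge0// ltW.
(* Both integrals are compared with the Riemann sum of this one step function, each at cost e/2. *)
pose c k := psi h k * phi (hpt h k).
have phi_cell y : `|phi y - phi (hpt h (cell 0 h y))| <= om.
  apply: uc; apply: le_trans (ltW hd).
  by have := cell_norm 0 y h0; rewrite subr0.
have phi_out y : cell 0 h y \notin box n.+1 (mesh M h) -> phi y = 0.
  move=> yb; apply: phiM; have [hb _ _] := meshP M0 h01.
  have := notin_box_norm h0 yb; have := cell_norm 0 y h0.
  have := ler_normB y (y - hpt h (cell 0 h y)).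
  by rewrite subr0 opprB addrC addrNK -natr1; lra.
have near_flap y : `|phi y * flap y - c (cell 0 h y)| <= E.
  have := unif h y; rewrite h0 hh1 => /(_ isT) u.
  set k := cell 0 h y; rewrite (_ : _ - c k =
    phi y * (flap y - psi h k) + psi h k * (phi y - phi (hpt h k))); last by rewrite /c; ring.
  apply: le_trans (ler_normD _ _) _; rewrite !normrM; apply: lerD.
    by apply: ler_pM; [exact: normr_ge0|exact: normr_ge0|exact: phiC|rewrite distrC; exact: u].
  by apply: ler_pM; [exact: normr_ge0|exact: normr_ge0|exact: psihB|exact: phi_cell].
have near_Q y : `|Qfun h (psi h) y * phi y - c (cell 0 h y)| <= E.
  rewrite Qfun_cell// -mulrBr normrM /E -[leLHS]add0r; apply: lerD.
    by rewrite mulr_ge0// ltW.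
  by apply: ler_pM; [exact: normr_ge0|exact: normr_ge0|exact: psihB|exact: phi_cell].
have int1 := @iint_riemann R n.+1 0 h (mesh M h) _ c (fun=> E) h0 (fun y _ => near_flap y).
have int2 := @iint_riemann R n.+1 0 h (mesh M h) _ c (fun=> E) h0 (fun y _ => near_Q y).
have sumE : h ^+ n.+1 * \sum_(k <- box n.+1 (mesh M h)) E <= W ^+ n.+1 * E.
  have := average_le (n := n) M0 h01 E0 (a := fun=> E).
  by rewrite ger0_norm// => /(_ (fun=> lexx _)); apply: le_trans; exact: ler_norm.
have WE : W ^+ n.+1 * E <= e / 2.
  have we : W ^+ n.+1 * eta * (C + 1) = e / 4.
    by rewrite /eta; field; rewrite !gt_eqF// ltr_wpDl.
  have wo : W ^+ n.+1 * om * (B + 1) = e / 4.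
    by rewrite /om; field; rewrite !gt_eqF// ltr_wpDl.
  have := mulr_ge0 (ltW WN0) (ltW eta0); have := mulr_ge0 (ltW WN0) (ltW om0).
  by rewrite /E mulrDr; lra.
rewrite -(subrKA (h ^+ n.+1 * \sum_(k <- box n.+1 (mesh M h)) c k)).
apply: le_trans (ler_normD _ _) _; rewrite [e]splitr; apply: lerD.
  apply: le_trans WE; apply: le_trans sumE; apply: int1 => y yb.
  by rewrite phi_out// mul0r.
rewrite distrC; apply: le_trans WE; apply: le_trans sumE; apply: int2 => y yb.
by rewrite phi_out// mulr0.
Unshelve. all: by end_near. Qed.

End Convergence.

Unset Implicit Arguments.

Theorem theorem10p3 (R : realType) (n : nat) (alpha : R)
  (Phi : 'rV[R]_n * 'rV[R]_n -> R)
  (psi : R -> 'rV[int]_n -> R) :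
  (1 <= n)%N -> 0 < alpha < 2 ->
  smooth Phi -> compact_support Phi ->
  (forall x : 'rV[R]_n, Phi (x, x) = 0) ->
  (forall h : R, 0 < h < 1 ->
     forall phi : 'rV[R]_n -> R, continuous phi -> compact_support phi ->
       intTh h phi (psi h) = intSh alpha h (fun x y => phi x * Phi (x, y))) ->
  forall phi : 'rV[R]_n -> R, continuous phi -> compact_support phi ->
    (fun h : R => iint (fun x => Qfun h (psi h) x * phi x)) @ 0^'+
      --> iint (fun x => phi x * fraclap alpha (fun x y => Phi (x, y)) x).
Proof.
case: n Phi psi => // n Phi psi _ alpha02 sPhi kPhi Phi0 Hpsi phi cphi kphi.
exact: (density_limit alpha02 sPhi kPhi Phi0 Hpsi).
Qed.
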